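(* Fix a prime power $q$. For each $k\in\mathbb{N}$, the $k$-fold divisor function $\tau_k$ on $\mathbb{F}_q[t]$ satisfies the growth condition, the Siegel-Walfisz bound and the Bombieri-Vinogradov type equidistribution property.
   Context: $\mathbb{F}_q$ is the finite field with $q$ elements, and $q$ is fixed. In all sums below $f$ runs over monic polynomials in $\mathbb{F}_q[t]$. An arithmetic function is a map $\psi:\mathbb{F}_q[t]\to\mathbb{C}$ (only its values on monic polynomials matter). $\tau_k(f)$ is the number of ways to write the monic polynomial $f$ as an (ordered) product of $k$ monic polynomials; $\tau=\tau_2$ is the number of monic divisors of $f$; and $\phi(m)=\#(\mathbb{F}_q[t]/(m))^{*}$. A (multiplicative) character $\chi$ modulo a non-constant polynomial $m$ is a character of $(\mathbb{F}_q[t]/(m))^{*}$, extended to $\mathbb{F}_q[t]$ by $\chi(f)=\chi(f \bmod m)$ if $(f,m)=1$ and $\chi(f)=0$ otherwise. It is principal if $\chi(f)=1$ for all $f$ with $(f,m)=1$. Its conductor is the monic $d\mid m$ of least degree such that $\chi$ is induced by a (primitive) character modulo $d$. Here $\log$ is the logarithm to base $q$. For an arithmetic function $\psi$ define: Growth condition: $\psi(f)=O(\tau(f)^{C})$ for some $C>0$. Siegel-Walfisz bound: for all sufficiently large $D>0$, for a non-principal character $\chi$ with conductor of degree $\le D\log N$, $$\sum_{\deg(f)=N}\psi(f)\chi(f)=O\left(\frac{q^N}{N^{3D}}\right),$$ with implied constant independent of $N$ and $\chi$. Bombieri-Vinogradov type equidistribution property: for $m,l\in\mathbb{F}_q[t]$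 with $m$ monic and $(m,l)=1$, let $$E(M;m,l;\psi)=\sum_{\substack{f\equiv l\ (\mathrm{mod}\ m)\\ \deg(f)=M}}\psi(f)-\frac{1}{\phi(m)}\sum_{\substack{(f,m)=1\\ \deg(f)=M}}\psi(f).$$ Then for any $A>0$ there exists $B=B(A)>0$ such that $$\sum_{\deg(m)\le \frac N2-B\log N}\ \max_{M\le N}\ \max_{(m,l)=1}|E(M;m,l;\psi)|\ll_A\frac{q^N}{N^A},$$ the outer sum being over monic $m$.
   Formalization: In the Siegel-Walfisz bound the modulus m of χ is required to satisfy deg m ≤ N^κ, for arbitrary fixed κ on which the implied constant may depend; without a bound on m it fails, e.g. when m is divisible by all primes P of degree N with χ(P)=1 for the inducing character. *)

(* Defs.v *)
From mathcomp Require Import all_boot all_order all_algebra.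
From mathcomp Require Import reals exp.
From mathcomp.real_closed Require Import complex.

Set Implicit Arguments.
Unset Strict Implicit.
Unset Printing Implicit Defensive.

Import Order.TTheory GRing.Theory Num.Theory.
Local Open Scope ring_scope.

Section FunctionField.
Variables (R : realType) (F : finFieldType).

Local Notation C := R[i].
Local Notation q := (#|F|).

Definition cabs (z : C) : R := Normc.normc z.

Definition logq (x : R) : R := ln x / ln q%:R.

(* The value 0 at f = 0 is irrelevant: deg is only used at nonzero f. *)
Definition deg (f : {poly F}) : nat := (size f).-1.

(* [{poly_n.+1 F}] is the finite type of polynomials of degree at most n. *)
Definition monic_of_deg (n : nat) : pred {poly_n.+1 F} :=
  fun f => ((f : {poly F}) \is monic) && (size f == n.+1).

(* The factors of a monic f are taken in the finite type of polynomials of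
   degree at most deg f, which loses nothing. *)
Definition tau (k : nat) (f : {poly F}) : nat :=
  #|[set g : {ffun 'I_k -> {poly_(size f) F}} |
      [forall i, (g i : {poly F}) \is monic]
      && (\prod_i (g i : {poly F}) == f)]|.

(* [{poly %/ p}] is F[t]/(p) only for p monic and non-constant, whence the
   passage to the monic generator of the ideal (m); for constant m,
   [{poly %/ monic_gen m}] is not F[t]/(m). *)
Definition monic_gen (m : {poly F}) : {poly F} := (lead_coef m)^-1 *: m.

(* For nonzero constant m, F[t]/(m) is the zero ring, with one unit. *)
Definition phi (m : {poly F}) : nat :=
  if (size m <= 1)%N then 1%N
  else #|[set x : {poly %/ monic_gen m} | x \is a GRing.unit]|.

(* Only the values on units are meaningful. *)
Definition is_character (m : {poly F}) (chi : {poly %/ monic_gen m} -> C) :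
    Prop :=
  chi 1 = 1 /\
  {in GRing.unit &, forall x y, chi (x * y) = chi x * chi y}.

Definition extend (m : {poly F}) (chi : {poly %/ monic_gen m} -> C)
    (f : {poly F}) : C :=
  if coprimep f m then chi (in_qpoly (monic_gen m) f) else 0.

Definition principal (m : {poly F}) (chi : {poly %/ monic_gen m} -> C) : Prop :=
  forall f : {poly F}, coprimep f m -> extend chi f = 1.

Definition induced_from (m : {poly F}) (chi : {poly %/ monic_gen m} -> C)
    (d : {poly F}) : Prop :=
  exists2 chi' : {poly %/ monic_gen d} -> C, is_character chi' &
    forall f : {poly F}, coprimep f m -> extend chi f = extend chi' f.

(* Meant for non-principal chi, which are never induced from the modulus 1;
   hence only non-constant divisors of m are considered. *)
Definition is_conductor (m : {poly F}) (chi : {poly %/ monic_gen m} -> C)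
    (d : {poly F}) : Prop :=
  let admissible e :=
    [/\ e \is monic, (1 < size e)%N, e %| m & induced_from chi e] in
  admissible d /\ forall e, admissible e -> (deg d <= deg e)%N.

Definition growth_condition (psi : {poly F} -> C) : Prop :=
  exists2 c : R, 0 < c &
  exists K : R, forall f : {poly F}, f \is monic ->
    cabs (psi f) <= K * (tau 2 f)%:R `^ c.

(* The moduli m may have any polynomial size deg m <= N ^ kappa, the implied
   constant depending on kappa but not on N, m or chi. Some such bound is
   needed: for psi = 1, if m is divisible by the conductor d of chi and by every
   prime P of degree N with chi'(P) = 1, where chi' mod d induces chi, and by no
   other prime, then the sum over deg f = N is, for N >= deg d, minus the number
   of these P, that is, of order q ^ N / N. *)
Definition siegel_walfisz (psi : {poly F} -> C) : Prop :=
  exists2 D0 : R, 0 < D0 &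
  forall D : R, D0 <= D ->
  forall kappa : nat,
  exists K : R, forall N : nat, (0 < N)%N ->
  forall (m : {poly F}) (chi : {poly %/ monic_gen m} -> C) (d : {poly F}),
    (1 < size m)%N -> (deg m <= N ^ kappa)%N ->
    is_character chi -> ~ principal chi ->
    is_conductor chi d -> (deg d)%:R <= D * logq N%:R ->
    cabs (\sum_(f : {poly_N.+1 F} | monic_of_deg f) psi f * extend chi f)
      <= K * (q%:R ^+ N / N%:R `^ (3 * D)).

Definition discrepancy (M : nat) (m l : {poly F}) (psi : {poly F} -> C) : C :=
  \sum_(f : {poly_M.+1 F} | monic_of_deg f && (m %| (f : {poly F}) - l)) psi f
  - (phi m)%:R^-1 *
    \sum_(f : {poly_M.+1 F} | monic_of_deg f && coprimep f m) psi f.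

(* The discrepancy depends on l only modulo m, so the maximum runs over the
   reduced residues l with deg l < deg m (over l = 0 alone when m = 1); m has
   degree at most N under the stated bound since B and logq N are nonnegative. *)
Definition bombieri_vinogradov (psi : {poly F} -> C) : Prop :=
  forall A : R, 0 < A ->
  exists2 B : R, 0 < B &
  exists K : R, forall N : nat, (0 < N)%N ->
    \sum_(m : {poly_N.+1 F} | ((m : {poly F}) \is monic) &&
            ((deg m)%:R <= N%:R / 2 - B * logq N%:R))
      \big[Num.max/0]_(M < N.+1)
        \big[Num.max/0]_(l : {poly_(deg m) F} | coprimep m l)
          cabs (discrepancy M m l psi)
    <= K * (q%:R ^+ N / N%:R `^ A).

End FunctionField.

(* Main.v *)
Require Import Defs.
From mathcomp Require Import all_boot all_order all_algebra.
From mathcomp Require Import all_fingroup all_solvable all_field all_character.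
From mathcomp Require Import zify ring lra.
From mathcomp Require Import boolp reals sequences exp.
From mathcomp.real_closed Require Import complex.
Set Implicit Arguments.
Unset Strict Implicit.
Unset Printing Implicit Defensive.
Import Order.TTheory GRing.Theory Num.Theory.
Local Open Scope ring_scope.

(* The sum of tau_k * chi over monic polynomials of degree N is the sum, over the
   k-tuples of degrees adding up to N, of products of the sums of chi over monic
   polynomials of a given degree; for non-principal chi modulo m these vanish as
   soon as the degree is at least deg m.  For chi induced from a small conductor
   d, sieving by the irreducible factors of m one at a time and Rankin's trick
   show that each product is exponentially smaller than trivial, which is the
   Siegel-Walfisz bound.  For Bombieri-Vinogradov, expand the discrepancy in
   characters and reduce to primitive ones.  Small conductors are treated as
   before.  For large ones, only tuples with all degrees below deg m <= N / 2
   matter; split off the largest degree and apply Cauchy-Schwarz and the large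
   sieve to the two factors.  Over F_q[t] the large sieve is Bessel's inequality:
   distinct primitive characters with conductors of degree j are exactly
   orthogonal on the polynomials of size at most L, for every L >= 2 j. *)

(** * Enumerations of polynomials and divisors *)

(** A modulus [m] that is far larger than the conductor [d] matters only through its irreducible
    factors, at most [N ^ kappa] in number. Weighted by [y ^- deg p] with [y = q / w], [w > 1],
    these add up to o(N), so sieving them out costs a factor exp(o(N)), whereas replacing [q] by [y]
    in the bound for the sums gains [w ^ N].

    For a large conductor of degree [a], Cauchy-Schwarz and two uses of the large sieve leave a
    power of [q] whose exponent depends on how the two partial degrees compare with [2 * a]. If both
    are short, the distance of the level from N / 2 provides the saving; if both are long, the size
    of the conductor does; if they differ, the longer one is still at most a fixed fraction of N,
    because the degree split off is the largest one but at most N / 2, and the saving is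
    exponential. Powers of N lost to moments of divisor functions are absorbed by the constant [B]
    in the level. *)

Lemma leq_expl (m n e : nat) : (m <= n -> m ^ e <= n ^ e)%N.
Proof. by case: e => // e; rewrite leq_exp2r. Qed.

Section Enumerations.
Variable F : finFieldType.
Implicit Types (f g h m : {poly F}) (n a b : nat).

(** Lists of plain polynomials, rather than the types [{poly_n F}] that vary with [n], allow sums
    over different degrees to be reindexed by permutations. *)
Definition polys n : seq {poly F} :=
  [seq val f | f : {poly_n F}].

Definition mpolys n : seq {poly F} :=
  [seq f <- polys n.+1 | (f \is monic) && (size f == n.+1)].

Lemma mem_polys n f : (f \in polys n) = (size f <= n)%N.
Proof.
apply/mapP/idP => [[g _ ->]|fn]; first exact: size_npoly.
by exists (npolyp n f); rewrite ?mem_enum //= npolypK.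
Qed.

Lemma polys_uniq n : uniq (polys n).
Proof. by rewrite map_inj_uniq ?enum_uniq //; apply: val_inj. Qed.

Lemma size_polys n : size (polys n) = (#|F| ^ n)%N.
Proof. by rewrite size_map -cardE card_npoly. Qed.

Lemma mem_mpolys n f : (f \in mpolys n) = (f \is monic) && (size f == n.+1).
Proof.
rewrite mem_filter mem_polys; case: (f \is monic) => //=.
by case: eqP => // ->; rewrite leqnn.
Qed.

Lemma mpolysP n f : reflect (f \is monic /\ size f = n.+1) (f \in mpolys n).
Proof. by rewrite mem_mpolys; apply: (iffP andP) => -[-> /eqP]. Qed.

Lemma monic_mpolys f : f \is monic -> f \in mpolys (deg f).
Proof.
move=> fm; apply/mpolysP; split=> //; rewrite /deg prednK //.
by rewrite size_poly_gt0 monic_neq0.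
Qed.

Lemma mpolys_uniq n : uniq (mpolys n).
Proof. by rewrite filter_uniq ?polys_uniq. Qed.

Lemma sum_monic_of_deg (V : nmodType) n (G : {poly F} -> V) :
  \sum_(f : {poly_n.+1 F} | monic_of_deg f) G f = \sum_(f <- mpolys n) G f.
Proof. by rewrite big_filter big_map big_enum_cond. Qed.

Lemma allpairs_divmod_uniq m (s : seq {poly F}) : m \is monic -> uniq s ->
  uniq [seq h * m + g | h <- s, g <- polys (deg m)].
Proof.
move=> mm us; have m0 := monic_neq0 mm.
have sm : size m = (deg m).+1 by rewrite /deg prednK // size_poly_gt0.
apply: allpairs_uniq; rewrite ?polys_uniq //.
move=> _ _ /allpairsP [[h g] [/= _ gm ->]] /allpairsP [[h' g'] [/= _ gm' ->]] /= e.
have ltm z : z \in polys (deg m) -> (size z < size m)%N by rewrite mem_polys sm.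
have [-> ->] := divp_modpP e (ltm _ gm').
by rewrite divp_addl_mul_small ?modp_addl_mul_small ?ltm.
Qed.

Lemma polys_divE m b : m \is monic ->
  perm_eq (polys (b + deg m))
          [seq h * m + g | h <- polys b, g <- polys (deg m)].
Proof.
move=> mm; have m0 := monic_neq0 mm.
have sm : size m = (deg m).+1 by rewrite /deg prednK // size_poly_gt0.
apply: uniq_perm; rewrite ?allpairs_divmod_uniq ?polys_uniq //.
move=> f; rewrite mem_polys; apply/idP/allpairsP => [fs|[[h g] /= []]].
  exists (f %/ m, f %% m); rewrite /= !mem_polys -divp_eq; split=> //.
    by rewrite size_divp // leq_subLR addnC.
  by rewrite -ltnS -sm ltn_modp.
rewrite !mem_polys => hb gd ->; rewrite (leq_trans (size_polyD _ _)) // geq_max.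
rewrite (leq_trans gd) ?leq_addl // andbT (leq_trans (size_polyMleq _ _)) // sm.
by rewrite addnS /= leq_add2r.
Qed.

(** Euclidean division by [m]: the quotient is monic of degree [b] and the remainder arbitrary, so
    each residue class modulo [m] is met equally often. All cancellation in character sums comes
    from this. *)
Lemma mpolys_divE m b : m \is monic ->
  perm_eq (mpolys (b + deg m))
          [seq h * m + g | h <- mpolys b, g <- polys (deg m)].
Proof.
move=> mm; have m0 := monic_neq0 mm.
have sm : size m = (deg m).+1 by rewrite /deg prednK // size_poly_gt0.
have sizeE h g : (size g <= deg m)%N -> h != 0 ->
    size (h * m + g) = (size h + deg m)%N /\ lead_coef (h * m + g) = lead_coef h.
  move=> gm h0; have shm : size (h * m) = (size h + deg m)%N.
    by rewrite size_proper_mul ?sm ?addnS // mulf_neq0 ?lead_coef_eq0.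
  have lt : (size g < size (h * m)%R)%N.
    by rewrite shm (leq_ltn_trans gm) // -addn1 addnC leq_add2r size_poly_gt0.
  rewrite size_polyDl // shm lead_coefDl // lead_coefM (monicP mm) mulr1.
  by [].
apply: uniq_perm; rewrite ?allpairs_divmod_uniq ?mpolys_uniq //.
move=> f; apply/idP/allpairsP => [fs|[[h g] /= []]].
  have := fs; rewrite mem_filter (perm_mem (polys_divE b.+1 mm)).
  case/andP=> /andP [fm /eqP sf] /allpairsP [[h g] /= []].
  rewrite !mem_polys => hb gd fE; exists (h, g); rewrite /= mem_polys; split=> //.
  have h0 : h != 0.
    apply/eqP => h0; move: sf; rewrite fE h0 mul0r add0r => sg.
    by move: gd; rewrite sg ltnNge leq_addl.
  have [s l] := sizeE h g gd h0.
  rewrite mem_mpolys monicE -l -fE (monicP fm) eqxx /=.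
  by move: sf; rewrite fE s -addSn => /addIn ->.
move=> /mpolysP [hm hs]; rewrite mem_polys => gd ->.
have [s l] := sizeE h g gd (monic_neq0 hm).
by rewrite mem_mpolys monicE l (monicP hm) eqxx s hs addSn /=.
Qed.

Lemma mpolys_dvdE g a b : g \in mpolys a ->
  perm_eq [seq f <- mpolys (a + b) | g %| f] [seq g * h | h <- mpolys b].
Proof.
case/mpolysP => gm sg; have g0 := monic_neq0 gm.
apply: uniq_perm; first by rewrite filter_uniq // mpolys_uniq.
  by rewrite map_inj_uniq ?mpolys_uniq //; apply: mulfI.
move=> f; rewrite mem_filter; apply/andP/mapP => [[]|[h /mpolysP [hm hs] ->]].
  move=> /dvdpP [h ->] /mpolysP [hm hs]; exists h; last by rewrite mulrC.
  have hm' : h \is monic by rewrite -(monicMr h gm).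
  apply/mpolysP; split=> //; move: hs; rewrite size_mul // ?monic_neq0 // sg.
  by rewrite addnS /= -addnS addnC => /addnI.
rewrite dvdp_mulr // mem_mpolys monicMl // hm size_mul ?monic_neq0 // sg hs.
by rewrite addnS addSn eqxx.
Qed.

Lemma mpolys0 : perm_eq (mpolys 0) [:: 1].
Proof.
apply: uniq_perm => //; first exact: mpolys_uniq.
move=> f; rewrite inE; apply/mpolysP/eqP => [[fm /eqP/size_poly1P [c _ fc]]|->].
  by move: fm; rewrite fc monicE lead_coefC => /eqP ->.
by rewrite monic1 size_poly1.
Qed.

Lemma size_mpolys n : size (mpolys n) = (#|F| ^ n)%N.
Proof.
(* Division by ['X^n] leaves the quotient 1 and an arbitrary remainder. *)
have := perm_size (mpolys_divE 0 (monicXn F n)).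
rewrite size_allpairs /deg size_polyXn /= add0n => ->.
by rewrite size_polys (perm_size mpolys0) mul1n.
Qed.

(** * Monic divisors, Dirichlet convolution and moments of the divisor function *)

Definition divs f : seq {poly F} :=
  [seq g <- polys (size f) | (g \is monic) && (g %| f)].

Definition dv f : nat := size (divs f).

Lemma mem_divs f g : f != 0 -> (g \in divs f) = (g \is monic) && (g %| f).
Proof.
move=> f0; rewrite mem_filter mem_polys andbC.
by case: (boolP (g %| f)) => [/dvdp_leq ->|]; rewrite ?andbT ?andbF.
Qed.

Lemma divs_uniq f : uniq (divs f).
Proof. by rewrite filter_uniq ?polys_uniq. Qed.

Lemma sum_divs (V : nmodType) n f (G : {poly F} -> V) : f \in mpolys n ->
  \sum_(g <- divs f) G g = \sum_(a < n.+1) \sum_(g <- mpolys a | g %| f) G g.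
Proof.
case/mpolysP => fm sf; have f0 := monic_neq0 fm.
transitivity (\sum_(g <- divs f) \sum_(a < n.+1 | deg g == a) G g).
  rewrite big_seq [RHS]big_seq; apply: eq_bigr => g.
  rewrite mem_divs // => /andP [gm /dvdp_leq -/(_ f0)]; rewrite sf /deg => gn.
  have gn' : ((size g).-1 < n.+1)%N by rewrite (leq_trans _ gn) // ltn_predL size_poly_gt0 monic_neq0.
  by rewrite (big_pred1 (Ordinal gn')) // => i; rewrite eq_sym -val_eqE.
rewrite (exchange_big_dep predT) //=; apply: eq_bigr => a _.
rewrite -big_filter -[RHS]big_filter; apply: perm_big; apply: uniq_perm.
- by rewrite filter_uniq // divs_uniq.
- by rewrite filter_uniq // mpolys_uniq.
move=> g; rewrite [LHS]mem_filter [RHS]mem_filter mem_divs // mem_mpolys.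
have [gm|] := boolP (g \is monic); last by rewrite !andbF.
by rewrite /= andbC /deg -[in RHS](prednK (_ : 0 < size g)%N) ?size_poly_gt0 ?monic_neq0.
Qed.

(** A pair of monic polynomials [g], [h] with degrees adding up to [n] arises from exactly one [f],
    namely [g * h]. *)
Lemma sum_dirichlet_conv (V : nmodType) n (G : {poly F} -> {poly F} -> V) :
  \sum_(f <- mpolys n) \sum_(g <- divs f) G g (f %/ g) =
  \sum_(a < n.+1) \sum_(g <- mpolys a) \sum_(h <- mpolys (n - a)) G g h.
Proof.
transitivity (\sum_(f <- mpolys n)
    \sum_(a < n.+1) \sum_(g <- mpolys a | g %| f) G g (f %/ g)).
  by apply: eq_big_seq => f; apply: sum_divs.
rewrite exchange_big /=; apply: eq_bigr => a _.
rewrite (exchange_big_dep predT) //=.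
apply: eq_big_seq => g ga; rewrite -big_filter.
have an : (a <= n)%N by rewrite -ltnS.
rewrite -{1}(subnKC an) (perm_big _ (mpolys_dvdE _ ga)) big_map.
have g0 : g != 0 by case/mpolysP: ga => /monic_neq0.
by apply: eq_bigr => h _; rewrite mulKp.
Qed.

(** [gcdp] is determined only up to a constant; membership in [divs] and equalities between moduli
    need the monic representative. *)
Definition mgcd f g : {poly F} := (lead_coef (gcdp f g))^-1 *: gcdp f g.

Lemma mgcdP f g : g != 0 ->
  [/\ mgcd f g \is monic, mgcd f g %| f, mgcd f g %| g & mgcd f g %= gcdp f g].
Proof.
move=> g0; have nz : lead_coef (gcdp f g) != 0.
  by rewrite lead_coef_eq0 gcdp_eq0 negb_and g0 orbT.
have e : mgcd f g %= gcdp f g by rewrite eqp_scale ?invr_eq0.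
by rewrite monicE lead_coefZ mulVf // !(eqp_dvdl _ e) dvdp_gcdr dvdp_gcdl.
Qed.

Lemma coprimep_div_mgcd f g : g != 0 -> coprimep (f %/ mgcd f g) (g %/ mgcd f g).
Proof.
move=> g0; have [_ _ _ e] := mgcdP f g0.
rewrite (eqp_coprimepl _ (eqp_divr f e)) (eqp_coprimepr _ (eqp_divr g e)).
by rewrite coprimep_div_gcd // g0 orbT.
Qed.

(** A divisor [c] of [f * g] is recovered from its gcd with [f] and the cofactor. The cofactor is
    coprime to [f] divided by that gcd, hence divides [g]. *)
Lemma dvM_le f g : f \is monic -> g \is monic -> (dv (f * g) <= dv f * dv g)%N.
Proof.
move=> fm gm; have f0 := monic_neq0 fm; have g0 := monic_neq0 gm.
have fg0 : f * g != 0 by rewrite mulf_neq0.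
rewrite -[X in (_ <= X)%N](size_allpairs (fun x y => (x, y))).
rewrite /dv -(size_map (fun c => (mgcd c f, c %/ mgcd c f))).
apply: uniq_leq_size.
  rewrite map_inj_in_uniq ?divs_uniq // => c c' _ _ [e1 e2].
  have [_ m3 _ _] := mgcdP c f0; have [_ m3' _ _] := mgcdP c' f0.
  by rewrite -[c](divpK m3) -[c'](divpK m3') e2 e1.
move=> _ /mapP [c + ->]; rewrite mem_divs // => /andP [cm cd].
have [m1 m3 m2 _] := mgcdP c f0.
apply/allpairsP; exists (mgcd c f, c %/ mgcd c f); split=> //=.
  by rewrite mem_divs // m1.
rewrite mem_divs //; apply/andP; split.
  by rewrite -(monicMr _ m1) divpK.
rewrite -(Gauss_dvdpr _ (coprimep_div_mgcd c f0)).
by rewrite -(@dvdp_mul2r _ (mgcd c f)) ?monic_neq0 // mulrAC !divpK.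
Qed.

Lemma dv_gt0 f : f != 0 -> (0 < dv f)%N.
Proof.
move=> f0; rewrite /dv -has_predT; apply/hasP; exists 1 => //.
by rewrite mem_divs // monic1 dvd1p.
Qed.

Lemma dv_dvd f g : f != 0 -> g %| f -> (dv g <= dv f)%N.
Proof.
move=> f0 gf; have g0 := dvdpN0 gf f0.
apply: uniq_leq_size; first exact: divs_uniq.
move=> c; rewrite !mem_divs // => /andP [-> cg] /=.
exact: dvdp_trans gf.
Qed.

(** Write one factor of [dv f ^ j.+1] as a sum over the divisors [g] and split the other [j] by
    submultiplicativity. The convolution squares the bound and the sum over [deg g] adds one power
    of [n.+1], so the exponents obey e' = 2 e + 1, e = 0 at the start. *)
Lemma sum_dv_exp n j :
  (\sum_(f <- mpolys n) dv f ^ j <= #|F| ^ n * n.+1 ^ (2 ^ j).-1)%N.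
Proof.
elim: j n => [|j IH] n.
  by rewrite (eq_bigr (fun=> 1%N)) // sum1_size size_mpolys muln1.
apply: (@leq_trans (\sum_(f <- mpolys n) \sum_(g <- divs f) dv g ^ j * dv (f %/ g) ^ j)%N).
  rewrite big_seq [X in (_ <= X)%N]big_seq; apply: leq_sum => f /mpolysP [fm _].
  rewrite expnS {1}/dv -sum1_size big_distrl /= big_seq [X in (_ <= X)%N]big_seq.
  apply: leq_sum => g; rewrite mem_divs ?monic_neq0 // => /andP [gm gf].
  rewrite mul1n -expnMn leq_expl // mulnC.
  have hm : f %/ g \is monic by rewrite -(monicMr _ gm) divpK.
  by rewrite -{1}(divpK gf) dvM_le.
rewrite (sum_dirichlet_conv n (fun g h => dv g ^ j * dv h ^ j)%N).
apply: (@leq_trans (\sum_(a < n.+1) #|F| ^ n * n.+1 ^ (2 * (2 ^ j).-1))%N).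
  apply: leq_sum => a _; rewrite -(eq_bigr _ (fun g _ => big_distrr _ _ _)) /=.
  rewrite -big_distrl /=; have an : (a <= n)%N by rewrite -ltnS.
  apply: leq_trans (leq_mul (IH _) (IH _)) _.
  rewrite mulnACA -expnD subnKC // mul2n -addnn expnD leq_mul2l; apply/orP; right.
  by apply: leq_mul; apply: leq_expl; rewrite ltnS ?leq_subr.
rewrite sum_nat_const card_ord mulnCA leq_mul2l -expnS; apply/orP; right.
rewrite leq_pexp2l // expnS; have := expn_gt0 2 j; lia.
Qed.

End Enumerations.

(** * Residues *)

(** In characteristic 0 the polynomial ['X^n - 1] is separable; its [n] distinct roots are enough
    roots of unity to include a primitive one. *)
Lemma primitive_root_exists (C : numClosedFieldType) n : (0 < n)%N ->
  {z : C | n.-primitive_root z}.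
Proof.
move=> n_gt0; pose p : {poly C} := 'X^n - 1.
have [r Dp] := closed_field_poly_normal p.
apply/sigW; rewrite (monicP _) ?monicXnsubC // scale1r in Dp.
have rn1 : all n.-unity_root r by apply/allP=> z; rewrite -root_prod_XsubC -Dp.
have sz_r : (n < (size r).+1)%N by rewrite -(size_prod_XsubC r id) -Dp size_XnsubC.
have [|z] := hasP (cyclic.has_prim_root n_gt0 rn1 _ sz_r); last by exists z.
by rewrite -separable_prod_XsubC -Dp cyclotomic.separable_Xn_sub_1 // pnatr_eq0 -lt0n.
Qed.

Lemma sum_const_seq (V : nmodType) (I : Type) (s : seq I) (x : V) :
  \sum_(i <- s) x = x *+ size s.
Proof. by rewrite big_const_seq count_predT iter_addr_0. Qed.

Section Residues.
Variable F : finFieldType.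
Implicit Types (e f g h m : {poly F}) (n a b : nat).
Local Notation polys := (polys F).
Local Notation mpolys := (mpolys F).

Lemma monic_size m : m \is monic -> size m = (deg m).+1.
Proof. by move=> mm; rewrite /deg prednK // size_poly_gt0 monic_neq0. Qed.

Lemma modp_polys m f : m \is monic -> f %% m \in polys (deg m).
Proof. by move=> mm; rewrite mem_polys -ltnS -monic_size // ltn_modp monic_neq0. Qed.

Lemma modp_small_polys m f : m \is monic -> f \in polys (deg m) -> f %% m = f.
Proof. by move=> mm; rewrite mem_polys => fs; rewrite modp_small // (monic_size mm) ltnS. Qed.

Lemma eq_modp m f g : (f %% m == g %% m) = (m %| f - g).
Proof. by rewrite -subr_eq0 /dvdp modpD modpN. Qed.

Lemma inverse_modp m f : coprimep f m -> exists g, m %| f * g - 1.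
Proof.
case/Bezout_coprimepP => -[u v] /= /eqp_size.
rewrite size_poly1 => /eqP/size_poly1P [c c0 e].
exists (c^-1 *: u); rewrite mulrC -scalerAl.
have -> : u * f = c%:P - v * m by rewrite -e addrK.
rewrite scalerBr (_ : c^-1 *: c%:P = 1); last by rewrite -mul_polyC -polyCM mulVf.
by rewrite addrAC subrr add0r dvdpNr dvdpZr ?invr_eq0 // dvdp_mull.
Qed.

(** For [m = 1] this is [[:: 0]], of size 1, in agreement with the convention in [phi]. *)
Definition units m : seq {poly F} := [seq f <- polys (deg m) | coprimep f m].

Lemma units_uniq m : uniq (units m).
Proof. by rewrite filter_uniq ?polys_uniq. Qed.

Lemma mem_units m f : (f \in units m) = coprimep f m && (f \in polys (deg m)).
Proof. by rewrite mem_filter. Qed.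

Lemma units_gt0 m : m \is monic -> (0 < size (units m))%N.
Proof.
move=> mm; rewrite -has_predT; apply/hasP; exists (1 %% m) => //.
by rewrite mem_units modp_polys // coprimep_modl coprime1p.
Qed.

Lemma perm_units_mul m f : m \is monic -> coprimep f m ->
  perm_eq [seq (f * g) %% m | g <- units m] (units m).
Proof.
move=> mm fm.
have inj : {in units m &, injective (fun g => (f * g) %% m)}.
  move=> g h; rewrite !mem_units => /andP [_ gs] /andP [_ hs] /eqP.
  rewrite eq_modp -mulrBr Gauss_dvdpr 1?coprimep_sym // -eq_modp.
  by rewrite !modp_small_polys // => /eqP.
have u : uniq [seq (f * g) %% m | g <- units m].
  by rewrite map_inj_in_uniq ?units_uniq.
apply: uniq_perm; rewrite ?units_uniq //.
have [] // := uniq_min_size u (s2 := units m) _ _; last by rewrite size_map.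
move=> _ /mapP [g + ->]; rewrite !mem_units modp_polys // => /andP [gm _].
by rewrite coprimep_modl coprimepMl fm gm.
Qed.

Lemma sum_mpolys_periodic (V : nmodType) m b (G : {poly F} -> V) :
  m \is monic -> (forall f, G (f %% m) = G f) ->
  \sum_(f <- mpolys (b + deg m)) G f = (\sum_(f <- polys (deg m)) G f) *+ #|F| ^ b.
Proof.
move=> mm per; rewrite (perm_big _ (mpolys_divE b mm)) big_allpairs_dep /=.
rewrite -size_mpolys -sum_const_seq; apply: eq_bigr => h _.
rewrite !big_seq; apply: eq_bigr => g gm.
by rewrite -per modpD modp_mull add0r per.
Qed.

Lemma sum_polys_periodic (V : nmodType) m b (G : {poly F} -> V) :
  m \is monic -> (forall f, G (f %% m) = G f) ->
  \sum_(f <- polys (b + deg m)) G f = (\sum_(f <- polys (deg m)) G f) *+ #|F| ^ b.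
Proof.
move=> mm per; rewrite (perm_big _ (polys_divE b mm)) big_allpairs_dep /=.
rewrite -size_polys -sum_const_seq; apply: eq_bigr => h _.
rewrite !big_seq; apply: eq_bigr => g gm.
by rewrite -per modpD modp_mull add0r per.
Qed.

(* For f coprime to e, the representative [f + e * gdcop f m] of f modulo e is coprime to m:
   an irreducible factor of m divides exactly one of its two terms. *)
Definition coprime_lift e m f := f + e * gdcop f m.

Lemma coprime_liftP e m f : m != 0 -> coprimep f e ->
  coprimep (coprime_lift e m f) m.
Proof.
move=> m0 fe; have Gf := coprimep_gdco f m0; rewrite /coprime_lift; set G := gdcop f m in Gf *.
have wG : coprimep (f + e * G) G.
  by rewrite coprimep_sym addrC coprimep_addl_mul.
have wf : coprimep (f + e * G) f.
  rewrite coprimep_sym -[X in X + _]mul1r coprimep_addl_mul coprimepMr fe.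
  by rewrite coprimep_sym.
(* If [f = 0], a polynomial coprime to [f] is a nonzero constant. Otherwise [m] divides [gdcop f m]
   times a power of [f], and the lift is coprime to both. *)
have [f0|f0] := eqVneq f 0.
  move: wf; rewrite {2}f0 coprimep0 => w1.
  by rewrite (eqp_coprimepl _ w1) coprime1p.
apply: (coprimep_dvdl (dvdp_gdcor m f0)).
by rewrite coprimepMr wG coprimep_expr.
Qed.
Lemma in_qpoly_unit h f : h \is monic -> (1 < size h)%N ->
  (in_qpoly h f \is a GRing.unit) = coprimep f h.
Proof.
move=> hm sh; have mkE : mk_monic h = h by rewrite /mk_monic sh hm.
rewrite -[LHS]/(coprimep (mk_monic h) (val (in_qpoly h f))) /= mkE.
by rewrite -Pdiv.IdomainMonic.modpE // coprimep_sym coprimep_modl.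
Qed.

Lemma in_qpoly_modp h f : h \is monic -> (1 < size h)%N ->
  in_qpoly h (f %% h) = in_qpoly h f.
Proof.
move=> hm sh; have mkE : mk_monic h = h by rewrite /mk_monic sh hm.
by apply: val_inj; rewrite /= mkE -!Pdiv.IdomainMonic.modpE // modp_id.
Qed.

End Residues.

(** * Dirichlet characters *)

Section DirichletCharacters.
Variables (F : finFieldType) (C : numClosedFieldType).
Implicit Types (d e f g h m r : {poly F}) (n a b : nat) (X Y : {poly F} -> C).
Local Notation polys := (polys F).
Local Notation mpolys := (mpolys F).

(** Characters as functions on all polynomials: those with different moduli then share one type and
    can be multiplied and compared. *)
Definition dirichlet m X : Prop :=
  [/\ X 1 = 1, {morph X : f g / f * g}, forall f, X (f %% m) = X f
    & forall f, ~~ coprimep f m -> X f = 0].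

Definition restr r X : {poly F} -> C :=
  fun f => if coprimep f r then X f else 0.

Definition principal_char m : {poly F} -> C := restr m (fun=> 1).

Lemma dirichlet_dvd m X f g : dirichlet m X -> m %| f - g -> X f = X g.
Proof. by case=> _ _ per _; rewrite -eq_modp => /eqP e; rewrite -per e per. Qed.

Lemma dirichlet_neq0 m X f : dirichlet m X -> coprimep f m -> X f != 0.
Proof.
move=> Xm /inverse_modp [g /(dirichlet_dvd Xm)]; case: Xm => X1 XM _ _.
by rewrite XM X1 => e; apply: contra_eq_neq e => ->; rewrite mul0r eq_sym oner_eq0.
Qed.

(** Euler's argument: multiplication by [f] permutes the units, hence preserves the nonzero product
    of the values of [X] over them. *)
Lemma dirichlet_unity m X f : m \is monic -> dirichlet m X -> coprimep f m ->
  X f ^+ size (units m) = 1.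
Proof.
move=> mm Xm fm; have [_ XM per _] := Xm.
have nz : \prod_(g <- units m) X g != 0.
  rewrite prodf_seq_neq0; apply/allP => g; rewrite mem_units => /andP [gm _].
  exact: dirichlet_neq0 Xm gm.
apply: (mulIf nz); rewrite mul1r -[RHS](perm_big _ (perm_units_mul mm fm)) big_map /=.
under [RHS]eq_bigr do rewrite per XM.
by rewrite big_split /= big_const_seq count_predT iter_mulr_1.
Qed.

Lemma dirichlet_norm m X f : m \is monic -> dirichlet m X -> coprimep f m ->
  `|X f| = 1.
Proof.
move=> mm Xm fm; apply/eqP; rewrite -(@pexpr_eq1 _ _ (size (units m))) //.
  by rewrite -normrX dirichlet_unity // normr1.
exact: units_gt0.
Qed.

Lemma dirichlet_norm_le1 m X f : m \is monic -> dirichlet m X -> `|X f| <= 1.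
Proof.
move=> mm Xm; case: (boolP (coprimep f m)) => [fm|]; first by rewrite (dirichlet_norm mm Xm).
by case: Xm => _ _ _ X0 /X0 ->; rewrite normr0 ler01.
Qed.

Lemma sum_units m X : dirichlet m X ->
  \sum_(f <- polys (deg m)) X f = \sum_(f <- units m) X f.
Proof.
case=> _ _ _ X0; rewrite [RHS]big_filter [RHS]big_mkcond; apply: eq_bigr => f _.
by case: ifPn => // /X0.
Qed.

Lemma sum_units_eq0 m X f0 : m \is monic -> dirichlet m X -> coprimep f0 m ->
  X f0 != 1 -> \sum_(f <- units m) X f = 0.
Proof.
move=> mm [_ XM per _] f0m; rewrite -subr_eq0 => nz; apply: (mulfI nz).
rewrite mulr0 mulrBl mul1r -[X in _ - X](perm_big _ (perm_units_mul mm f0m)).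
rewrite big_map /= mulr_sumr -sumrB big1 // => f _.
by rewrite per XM subrr.
Qed.

Lemma dirichlet_principal m : m \is monic -> dirichlet m (principal_char m).
Proof.
move=> mm; split; rewrite /principal_char /restr.
- by rewrite coprime1p.
- by move=> f g; rewrite coprimepMl; case: coprimep; case: coprimep; rewrite ?mulr0 ?mulr1 ?mul0r.
- by move=> f; rewrite coprimep_modl.
by move=> f /negPf ->.
Qed.

Lemma dirichlet_mul_conj m1 m2 X Y : dirichlet m1 X -> dirichlet m2 Y ->
  dirichlet (m1 * m2) (fun f => X f * (Y f)^*).
Proof.
move=> Xm Ym; have [X1 XM perX X0] := Xm; have [Y1 YM perY Y0] := Ym; split.
- by rewrite X1 Y1 conjC1 mulr1.
- by move=> f g; rewrite XM YM rmorphM /= mulrACA.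
- move=> f; have dv : m1 * m2 %| f %% (m1 * m2) - f by rewrite -eq_modp modp_id.
  rewrite (dirichlet_dvd Xm (g := f)); last by rewrite (dvdp_trans _ dv) ?dvdp_mulIl.
  by rewrite (dirichlet_dvd Ym (g := f)) // (dvdp_trans _ dv) ?dvdp_mulIr.
move=> f; rewrite coprimepMr negb_and => /orP [/X0 ->|/Y0 ->]; first by rewrite mul0r.
by rewrite conjC0 mulr0.
Qed.

Lemma dirichlet_mul m X Y : dirichlet m X -> dirichlet m Y ->
  dirichlet m (fun f => X f * Y f).
Proof.
move=> [X1 XM perX X0] [Y1 YM perY Y0]; split.
- by rewrite X1 Y1 mulr1.
- by move=> f g; rewrite XM YM mulrACA.
- by move=> f; rewrite perX perY.
by move=> f /X0 ->; rewrite mul0r.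
Qed.

Lemma restr_periodic m X f : (forall g, X (g %% m) = X g) ->
  restr m X (f %% m) = restr m X f.
Proof. by move=> per; rewrite /restr coprimep_modl per. Qed.

Lemma dirichlet_ext m X Y : dirichlet m X -> dirichlet m Y ->
  (forall f, coprimep f m -> X f = Y f) -> X = Y.
Proof.
move=> [_ _ _ X0] [_ _ _ Y0] e; apply: funext => f.
by case: (boolP (coprimep f m)) => [/e|fm] //; rewrite X0 ?Y0.
Qed.

(* A character is determined by its values on the residues, each of which is 0
   or a root of unity of order #units. *)
Lemma dirichlet_finite m : m \is monic ->
  exists s : seq ({poly F} -> C), uniq s /\ forall X, X \in s <-> dirichlet m X.
Proof.
move=> mm; have n0 := units_gt0 mm.
have [r Dp] := closed_field_poly_normal ('X^(size (units m)) - 1 : {poly C}).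
rewrite (monicP _) ?monicXnsubC // scale1r in Dp.
pose decode (c : {ffun {poly_(deg m) F} -> 'I_(size r).+1}) f : C :=
  (0 :: r)`_(c (npolyp (deg m) (f %% m))).
exists (undup [seq X <- [seq decode c | c : {ffun {poly_(deg m) F} -> 'I_(size r).+1}]
               | `[< dirichlet m X >]]).
split; first exact: undup_uniq.
move=> X; rewrite mem_undup mem_filter; split=> [/andP [/asboolP //]|Xm].
rewrite asboolT //=; apply/mapP.
have Xr f : X f \in 0 :: r.
  case: (boolP (coprimep f m)) => fm; last by case: Xm => _ _ _ /(_ f fm) ->; rewrite mem_head.
  rewrite inE -root_prod_XsubC -Dp rootE !hornerE dirichlet_unity // subrr eqxx.
  by rewrite orbT.
exists [ffun p : {poly_(deg m) F} => inord (index (X (val p)) (0 :: r))].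
  by rewrite mem_enum.
apply: funext => f; rewrite /decode ffunE inordK.
  rewrite nth_index //= npolypK; last by have := modp_polys f mm; rewrite mem_polys.
  by case: Xm.
by rewrite -[(size r).+1]/(size (0 :: r)) index_mem.
Qed.

(* Linear characters of the finite abelian group of units separate points; their
   values are transported from algC to C through primitive roots of unity. *)
Lemma dirichlet_separates m f : m \is monic -> coprimep f m -> ~~ (m %| f - 1) ->
  exists2 X, dirichlet m X & X f != 1.
Proof.
move=> mm fm fn1.
have sm : (1 < size m)%N.
  rewrite ltnNge; apply: contra fn1 => sm.
  have /size_poly1P [c c0 ->] : size m == 1%N.
    by rewrite eqn_leq sm size_poly_gt0 monic_neq0.
  by rewrite (eqp_dvdl _ (_ : _ %= 1)) ?dvd1p // -size_poly_eq1 size_polyC c0.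
(* Non-units are sent to the default 1; the character [X] built below is 0 on them. *)
pose u g : {unit {poly %/ m}} := insubd (1%g : {unit {poly %/ m}}) (in_qpoly m g).
have uE g : coprimep g m -> FinRing.uval (u g) = in_qpoly m g.
  by move=> gm; rewrite val_insubd in_qpoly_unit // gm.
have uM g h : coprimep g m -> coprimep h m -> u (g * h) = (u g * u h)%g.
  move=> gm hm; apply: val_inj.
  change (FinRing.uval (u (g * h)) = FinRing.uval (u g) * FinRing.uval (u h)).
  rewrite !uE //; first by rewrite in_qpolyM.
  by rewrite coprimepMl gm.
have u1 : u 1 = 1%g 
  by apply: val_inj; change (FinRing.uval (u 1) = 1); rewrite uE ?coprime1p // in_qpoly1.
have um g : u (g %% m) = u g by rewrite /u in_qpoly_modp.
have uf : u f != 1%g.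
  apply: contra fn1 => /eqP e; have := uE f fm; rewrite e -u1 uE ?coprime1p //.
  move/(congr1 val); rewrite /= -!Pdiv.IdomainMonic.modpE ?monic_mk_monic //.
  by rewrite /mk_monic sm mm -eq_modp => ->.
pose G := [set: {unit {poly %/ m}}]%G.
have [i [lin fker]] : exists i : Iirr G, 'chi_i \is a linear_char /\ u f \notin cfker 'chi_i.
  have := cap_cfker_lin_irr G; rewrite (derG1P _); last first.
    by apply/centsP => x _ y _; apply: val_inj; rewrite /= mulrC.
  move=> e; have : u f \notin (1%g : {set {unit {poly %/ m}}}) by rewrite inE.
  rewrite -e; apply: contraNP => /forallNP hn.
  apply/bigcapP => i lin; case: (boolP (u f \in cfker 'chi_i)) => // nf.
  by case: (hn i).
have n0 : (0 < #|G|)%N by rewrite cardG_gt0.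
have [z zP] := primitive_root_exists algC n0.
have [t tP] := primitive_root_exists C n0.
have chin g : 'chi_i (u g) ^+ #|G| = 1.
  by rewrite -lin_charX ?inE // expg_cardG ?inE // lin_char1.
pose k g := sval (prim_rootP zP (chin g)).
have kE g : 'chi_i (u g) = z ^+ k g by rewrite /k; case: prim_rootP.
pose X g := if coprimep g m then t ^+ k g else 0.
(* Both equalities say that [a] and [b] agree modulo [#|G|], so every identity between values of
   ['chi_i] passes to [X]. *)
have eqt a b : (t ^+ a == t ^+ b) = (z ^+ a == z ^+ b).
  by rewrite (eq_prim_root_expr tP) (eq_prim_root_expr zP).
exists X.
  split; rewrite /X.
  - rewrite coprime1p; apply/eqP; rewrite -(expr0 t) eqt -kE u1 lin_char1 //.
  - move=> g h; rewrite coprimepMl; case: (boolP (coprimep g m)) => gm; last by rewrite mul0r.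
    case: (boolP (coprimep h m)) => hm; last by rewrite mulr0.
    by apply/eqP; rewrite -exprD eqt exprD -!kE uM // lin_charM ?inE.
  - move=> g; rewrite coprimep_modl; case: ifP => // _.
    by apply/eqP; rewrite eqt -!kE um.
  by move=> g /negPf ->.
rewrite /X fm -(expr0 t) eqt -kE expr0; apply: contra fker => /eqP e.
by rewrite cfkerEirr inE e lin_char1.
Qed.

End DirichletCharacters.

Lemma bessel (C : numClosedFieldType) (T : Type) (s : seq T) (I : eqType)
    (r : seq I) (Y : I -> T -> C) (w : I -> C) (a : T -> C) :
  uniq r -> (forall i, 0 < w i) ->
  (forall i j, i \in r -> j \in r ->
     \sum_(t <- s) Y i t * (Y j t)^* = if i == j then w i else 0) ->
  \sum_(i <- r) (w i)^-1 * `|\sum_(t <- s) a t * Y i t| ^+ 2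
    <= \sum_(t <- s) `|a t| ^+ 2.
Proof.
move=> ur w0 orth; pose A i := \sum_(t <- s) a t * Y i t.
(* [S] is the orthogonal projection of [a] onto the span of the conjugates of the [Y i]. The claim
   is that [a - S] has nonnegative square norm: the three sums [aS], [Sa], [SS] all equal [T0]. *)
pose S t := \sum_(i <- r) (w i)^-1 * A i * (Y i t)^*.
set T0 := (X in X <= _).
have wc i : (w i)^* = w i by apply/CrealP; rewrite gtr0_real.
have T0c : T0^* = T0.
  rewrite /T0 rmorph_sum; apply: eq_bigr => i _.
  by rewrite rmorphM rmorphXn /= conj_normC fmorphV /= wc.
have aS : \sum_(t <- s) a t * (S t)^* = T0.
  rewrite /T0 /S; under eq_bigr do rewrite rmorph_sum mulr_sumr.
  rewrite exchange_big /=; apply: eq_bigr => i _; rewrite normCK.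
  rewrite [_ * _^*]mulrC mulrA -/(A i) [RHS]mulr_sumr; apply: eq_bigr => t _.
  rewrite !rmorphM /= conjCK fmorphV /= wc; ring.
have Sa : \sum_(t <- s) S t * (a t)^* = T0.
  rewrite -T0c -aS rmorph_sum; apply: eq_bigr => t _.
  by rewrite rmorphM /= conjCK mulrC.
have SS : \sum_(t <- s) S t * (S t)^* = T0.
  rewrite -{1}aS; under eq_bigr do rewrite {1}/S mulr_suml.
  rewrite aS exchange_big /= /T0 big_seq [RHS]big_seq; apply: eq_bigr => i ir.
  rewrite -/(A i) normCK.
  have -> : \sum_(t <- s) (w i)^-1 * A i * (Y i t)^* * (S t)^*
     = (w i)^-1 * A i * \sum_(j <- r) ((w j)^-1 * (A j)^* * \sum_(t <- s) Y j t * (Y i t)^*).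
    rewrite mulr_sumr; under [RHS]eq_bigr do rewrite mulrA mulr_sumr.
    rewrite [RHS]exchange_big /=; apply: eq_bigr => t _.
    rewrite /S rmorph_sum mulr_sumr; apply: eq_bigr => j _.
    rewrite !rmorphM /= conjCK fmorphV /= wc; ring.
  rewrite (bigD1_seq i) //= orth // eqxx big1_seq ?addr0.
    by field; rewrite gt_eqF.
  by move=> j /andP [ji jr]; rewrite orth // (negPf ji) mulr0.
have : 0 <= \sum_(t <- s) `|a t - S t| ^+ 2 by apply: sumr_ge0 => t _; rewrite exprn_ge0.
rewrite (_ : \sum_(t <- s) _ = \sum_(t <- s) `|a t| ^+ 2 - T0) ?subr_ge0 //.
transitivity (\sum_(t <- s) `|a t| ^+ 2 - \sum_(t <- s) a t * (S t)^*
    - \sum_(t <- s) S t * (a t)^* + \sum_(t <- s) S t * (S t)^*).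
  rewrite -!sumrB -big_split /=; apply: eq_bigr => t _.
  by rewrite !normCK rmorphB /=; ring.
by rewrite aS Sa SS subrK.
Qed.

(** * Orthogonality over all characters of a modulus, and the expansion of the discrepancy *)

Section CharacterFamily.
Variables (F : finFieldType) (C : numClosedFieldType).
Implicit Types (d e f g h l m r : {poly F}) (n a b : nat) (X Y : {poly F} -> C).
Local Notation polys := (polys F).
Local Notation mpolys := (mpolys F).

Definition chars m : seq ({poly F} -> C) :=
  if pselect (exists s : seq ({poly F} -> C), uniq s /\ forall X, X \in s <-> dirichlet m X)
  is left H then sval (cid H) else [::].

Lemma charsP m : m \is monic ->
  uniq (chars m) /\ forall X, X \in chars m <-> dirichlet m X.
Proof.
move=> mm; rewrite /chars; case: pselect => [H|[]]; first by case: cid.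
exact: dirichlet_finite.
Qed.

Lemma mem_chars m X : m \is monic -> X \in chars m <-> dirichlet m X.
Proof. by move=> /charsP []. Qed.

Lemma perm_chars_mul m Y : m \is monic -> dirichlet m Y ->
  perm_eq [seq (fun f => Y f * X f) | X <- chars m] (chars m).
Proof.
move=> mm Ym; have [u _] := charsP mm.
have um : uniq [seq (fun f => Y f * X f) | X <- chars m].
  rewrite map_inj_in_uniq // => X X' /(mem_chars _ mm) Xm /(mem_chars _ mm) Xm' e.
  apply: (dirichlet_ext Xm Xm') => f fm.
  by have := congr1 (@^~ f) e; apply: mulfI; apply: dirichlet_neq0 Ym fm.
apply: uniq_perm => //.
have [] // := uniq_min_size um (s2 := chars m) _ _; last by rewrite size_map.
move=> _ /mapP [X /(mem_chars _ mm) Xm ->]; apply/mem_chars => //.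
exact: dirichlet_mul.
Qed.

Lemma sum_chars_eq0 m f : m \is monic -> coprimep f m -> ~~ (m %| f - 1) ->
  \sum_(X <- chars m) X f = 0.
Proof.
move=> mm fm fn1; have [Y Ym] := dirichlet_separates C mm fm fn1.
rewrite -subr_eq0 => nz; apply: (mulfI nz).
rewrite mulr0 mulrBl mul1r -[X in _ - X](perm_big _ (perm_chars_mul mm Ym)) big_map /=.
by rewrite mulr_sumr subrr.
Qed.

Lemma sum_chars_1 m f : m \is monic -> m %| f - 1 ->
  \sum_(X <- chars m) X f = (size (chars m))%:R.
Proof.
move=> mm f1; rewrite -sum_const_seq big_seq [RHS]big_seq; apply: eq_bigr => X.
by move=> /(mem_chars _ mm) Xm; rewrite (dirichlet_dvd Xm f1); case: Xm.
Qed.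

Lemma principal_in m : m \is monic -> principal_char C m \in chars m.
Proof. by move=> mm; apply/mem_chars => //; apply: dirichlet_principal. Qed.

Lemma nonprincipal_witness m X : dirichlet m X -> X != principal_char C m ->
  exists2 f, coprimep f m & X f != 1.
Proof.
move=> Xm nX; apply: contrapT => H; case/eqP: nX.
case: (Xm) => _ _ _ X0; apply: funext => f; rewrite /principal_char /restr.
case: (boolP (coprimep f m)) => [fm|/X0] //.
by apply: contrapT => /eqP ne; apply: H; exists f.
Qed.

Lemma sum_nonprincipal m X : m \is monic -> dirichlet m X -> X != principal_char C m ->
  \sum_(f <- polys (deg m)) X f = 0.
Proof.
move=> mm Xm /(nonprincipal_witness Xm) [f fm Xf].
by rewrite (sum_units Xm) (sum_units_eq0 mm Xm fm Xf).
Qed.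

Lemma sum_principal m :
  \sum_(f <- polys (deg m)) principal_char C m f = (size (units m))%:R.
Proof. by rewrite -big_mkcond -big_filter -/(units m) sum_const_seq. Qed.

Lemma size_chars m : m \is monic -> size (chars m) = size (units m).
Proof.
move=> mm; apply/eqP; rewrite -(eqr_nat C).
(* The double sum in two orders: summed over characters first, only the residue of 1 survives;
   summed over residues first, only the principal character. The residue is written [1 %% m] because
   it is 0 for [m = 1]. *)
transitivity ((\sum_(f <- units m) \sum_(X <- chars m) X f : C) == (size (units m))%:R).
  congr (_ == _); rewrite (bigD1_seq (1 %% m)) ?units_uniq //=; last first.
    by rewrite mem_units modp_polys // coprimep_modl coprime1p.
  rewrite [X in _ + X]big1_seq ?addr0 => [|f]; first by rewrite sum_chars_1 // -eq_modp modp_id.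
  rewrite mem_units => /andP [f1 /andP [fm fs]]; rewrite sum_chars_eq0 //.
  by rewrite -eq_modp (modp_small_polys mm fs).
rewrite exchange_big /= (bigD1_seq (principal_char C m)) ?principal_in //=; last first.
  by have [] := charsP mm.
rewrite [X in _ + X]big1_seq ?addr0 => [|X /andP [nX /(mem_chars _ mm) Xm]].
  by rewrite -(sum_units (dirichlet_principal C mm)) sum_principal eqxx.
by rewrite -(sum_units Xm) sum_nonprincipal.
Qed.

Lemma phi_units m : m \is monic -> phi m = size (units m).
Proof.
move=> mm; rewrite /phi; case: leqP => [sm|sm].
  have /size_poly1P [c _ mc] : size m == 1%N.
    by rewrite eqn_leq sm size_poly_gt0 monic_neq0.
  have m1 : m = 1 by move: mm; rewrite mc monicE lead_coefC => /eqP ->.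
  rewrite /units /deg m1 size_poly1 /= -sum1_size big_filter big_map big_enum_cond /=.
  rewrite (eq_bigl predT) => [|f]; last exact: coprimep1.
  by rewrite sum1_card card_npoly expn0.
have -> : monic_gen m = m by rewrite /monic_gen (monicP mm) invr1 scale1r.
have mkE : mk_monic m = m by rewrite /mk_monic sm mm.
(* [{poly %/ h}] consists of the polynomials smaller than [mk_monic h]; with [h] arbitrary,
   [mk_monic m = m] is rewritten only after the quotient type has disappeared. *)
have gen (h : {poly F}) : #|[set x : {poly %/ h} | x \is a GRing.unit]| =
    size [seq f <- polys (size (mk_monic h)).-1 | coprimep f (mk_monic h)].
  rewrite -[RHS]sum1_size big_filter big_map big_enum_cond /= -sum1_card.
  by apply: eq_bigl => x; rewrite inE coprimep_sym.
by rewrite gen mkE.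
Qed.

(** With [l'] inverse to [l], the congruence of [f] to [l] reads [m %| l' * f - 1] and is detected
    by summing [X (l' * f)] over all characters. The principal one yields exactly the mean that is
    subtracted. *)
Lemma discrepancy_chars M m l (psi : {poly F} -> C) l' :
  m \is monic -> coprimep l m -> m %| l * l' - 1 ->
  (\sum_(f <- mpolys M | (m %| f - l)%R) psi f
    - (size (units m))%:R^-1 * \sum_(f <- mpolys M | coprimep f m) psi f)
  = (size (units m))%:R^-1 *
    \sum_(X <- chars m | X != principal_char C m)
       X l' * \sum_(f <- mpolys M) psi f * X f.
Proof.
move=> mm lm ll'; set k := size _.
have l'm : coprimep l' m.
  have : coprimep (l * l') m.
    have e : (l * l') %% m = 1 %% m by apply/eqP; rewrite eq_modp.
    by rewrite -coprimep_modl e coprimep_modl coprime1p.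
  by rewrite coprimepMl => /andP [].
have k0 : (k%:R : C) != 0 by rewrite pnatr_eq0 -lt0n units_gt0.
apply: (mulfI k0); rewrite mulrBr !mulVKf //.
have -> : \sum_(f <- mpolys M | coprimep f m) psi f
   = principal_char C m l' * \sum_(f <- mpolys M) psi f * principal_char C m f.
  rewrite /principal_char /restr l'm mul1r big_mkcond; apply: eq_bigr => f _.
  by case: coprimep; rewrite ?mulr1 ?mulr0.
rewrite -[X in _ = X](addKr (principal_char C m l' * \sum_(f <- mpolys M) psi f * principal_char C m f)).
rewrite -(bigD1_seq (principal_char C m) (r := chars m) (F := fun X => X l' * \sum_(f <- mpolys M) psi f * X f)) ?principal_in //=; last by have [] := charsP mm.
rewrite [RHS]addrC; congr (_ - _).
under [RHS]eq_bigr do rewrite mulr_sumr.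
rewrite exchange_big /= mulr_sumr [LHS]big_mkcond; apply: eq_bigr => f _.
have -> : \sum_(X <- chars m) X l' * (psi f * X f) = psi f * \sum_(X <- chars m) X (l' * f).
  rewrite mulr_sumr big_seq [RHS]big_seq; apply: eq_bigr => X /(mem_chars _ mm) [_ XM _ _].
  by rewrite XM; ring.
have dE : (m %| f - l) = (m %| l' * f - 1).
  rewrite -(@Gauss_dvdpr _ (f - l) l') 1?coprimep_sym // mulrBr.
  have -> : l' * f - l' * l = (l' * f - 1) - (l * l' - 1) by ring.
  by rewrite dvdp_subl.
rewrite dE; case: ifPn => [d1|nd1].
  by rewrite sum_chars_1 // size_chars // mulrC.
case: (boolP (coprimep (l' * f) m)) => [cop|ncop].
  by rewrite sum_chars_eq0 ?mulr0.
rewrite big1_seq ?mulr0 // => X /andP [_ /(mem_chars _ mm) [_ _ _ X0]].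
exact: X0.
Qed.

End CharacterFamily.

(** * Primitive characters and the large sieve *)

Lemma mulrn_nat (x n : nat) : x *+ n = (x * n)%N.
Proof. by elim: n => [|n IH]; rewrite ?muln0 // mulrS IH mulnS. Qed.

Section Totient.
Variables (F : finFieldType).
Implicit Types (d e f g h l m r : {poly F}) (n a b : nat).
Local Notation polys := (polys F).
Local Notation mpolys := (mpolys F).

Lemma degM f g : f \is monic -> g \is monic -> deg (f * g) = (deg f + deg g)%N.
Proof.
move=> fm gm; rewrite /deg size_mul ?monic_neq0 // (monic_size fm) (monic_size gm) /=.
by rewrite addnS.
Qed.

Lemma modp_dvd_modp e m f : e %| m -> (f %% m) %% e = f %% e.
Proof.
move=> em; apply/eqP; rewrite eq_modp (dvdp_trans em) //.
by rewrite -eq_modp modp_id.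
Qed.

(** [coprime_lift] sends units modulo [e] to units modulo [m], injectively, since reduction modulo
    [e] undoes it. *)
Lemma units_dvd e m : e \is monic -> m \is monic -> e %| m ->
  (size (units e) <= size (units m))%N.
Proof.
move=> em mm edm; rewrite -(size_map (fun u => coprime_lift e m u %% m)).
have red u : u \in units e -> (coprime_lift e m u %% m) %% e = u.
  rewrite mem_units => /andP [_ us].
  by rewrite modp_dvd_modp // /coprime_lift modpD modp_mulr addr0 modp_small_polys.
apply: uniq_leq_size.
  rewrite map_inj_in_uniq ?units_uniq // => u v /red {2}<- /red {2}<- ->.
  by [].
move=> _ /mapP [u + ->]; rewrite !mem_units modp_polys // andbT coprimep_modl => /andP [ue _].
exact: coprime_liftP (monic_neq0 mm) ue.
Qed.

(* The residues x modulo d * r coprime to d are sorted according to their greatest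
   common divisor g with r: x / g is then a unit modulo d * (r / g). *)
Lemma units_mul_ge d r : d \is monic -> r \is monic ->
  (size (units d) * #|F| ^ deg r <= dv r * size (units (d * r)%R))%N.
Proof.
move=> dm rm; have r0 := monic_neq0 rm.
pose s := [seq x <- polys (deg r + deg d) | coprimep x d].
have -> : (size (units d) * #|F| ^ deg r)%N = size s.
  have e : (\sum_(x <- polys (deg r + deg d)) (if coprimep x d then 1 else 0) =
      (\sum_(x <- polys (deg d)) (if coprimep x d then 1 else 0)) * #|F| ^ deg r)%N.
    rewrite -mulrn_nat; apply: (@sum_polys_periodic F nat d _ (fun x => if coprimep x d then 1 else 0)%N) => //.
    by move=> f; rewrite coprimep_modl.
  rewrite /s -[RHS]sum1_size big_filter big_mkcond e -big_mkcond -big_filter.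
  by rewrite sum1_size.
rewrite -(size_map (fun x => (mgcd x r, x %/ mgcd x r)) s).
apply: (@leq_trans (size [seq (g, y) | g <- divs r, y <- units (d * (r %/ g))])).
  apply: uniq_leq_size.
    rewrite map_inj_in_uniq ?filter_uniq ?polys_uniq // => c c' _ _ [e1 e2].
    have [_ m3 _ _] := mgcdP c r0; have [_ m3' _ _] := mgcdP c' r0.
    by rewrite -[c](divpK m3) -[c'](divpK m3') e2 e1.
  move=> _ /mapP [x + ->]; rewrite mem_filter mem_polys => /andP [xd xs].
  have [gm gx gr _] := mgcdP x r0; set g := mgcd x r in gm gx gr *.
  have hm : r %/ g \is monic by rewrite -(monicMr _ gm) divpK.
  apply/allpairsPdep; exists g, (x %/ g); split=> //; first by rewrite mem_divs // gm.
  rewrite mem_units coprimepMr coprimep_div_mgcd // andbT.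
  rewrite (coprimep_dvdr (divp_dvd gx)) //= mem_polys degM // size_divp ?monic_neq0 //.
  by rewrite leq_subLR -/(deg g) addnCA -degM // [_ * (r %/ g)]mulrC divpK // addnC.
rewrite size_allpairs_dep sumnE big_map /dv -sum1_size big_distrl /=.
rewrite big_seq [X in (_ <= X)%N]big_seq; apply: leq_sum => g.
rewrite mem_divs // => /andP [gm gr]; rewrite mul1n.
have hm : r %/ g \is monic by rewrite -(monicMr _ gm) divpK.
by apply: units_dvd; rewrite ?monicMl // dvdp_mul // divp_dvd.
Qed.

End Totient.

Section PrimitiveCharacters.
Variables (F : finFieldType) (C : numClosedFieldType).
Implicit Types (d e f g h l m r : {poly F}) (n a b L : nat) (X Y : {poly F} -> C).
Local Notation polys := (polys F).
Local Notation mpolys := (mpolys F).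

(** Primitivity through the kernel: a character trivial on the units congruent to 1 modulo [e] is
    induced from [e], by [induced_char]. *)
Definition primitive_char d Y : Prop := dirichlet d Y /\
  forall e, e \is monic -> e %| d ->
    (forall f, coprimep f d -> e %| f - 1 -> Y f = 1) -> e = d.

(** On units modulo [m] the value of [X] depends only on the class modulo [e]. So [Y f] can be taken
    as the value of [X] at any lift of [f] coprime to [m], and the choice of lift is immaterial. *)
Lemma induced_char m e X : m \is monic -> e \is monic -> e %| m ->
  dirichlet m X -> (forall f, coprimep f m -> e %| f - 1 -> X f = 1) ->
  exists2 Y, dirichlet e Y & X = restr m Y.
Proof.
move=> mm em edm Xm ker; have m0 := monic_neq0 mm; have [X1 XM per X0] := Xm.
have eqX f g : coprimep f m -> coprimep g m -> e %| f - g -> X f = X g.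
  move=> fm gm efg; have [g' gg'] := inverse_modp gm.
  have g'm : coprimep g' m.
    have e' : (g * g') %% m = 1 %% m by apply/eqP; rewrite eq_modp.
    have : coprimep (g * g') m by rewrite -coprimep_modl e' coprimep_modl coprime1p.
    by rewrite coprimepMl => /andP [].
  apply: (mulIf (dirichlet_neq0 Xm g'm)); rewrite -!XM (dirichlet_dvd Xm gg') X1.
  apply: ker; first by rewrite coprimepMl fm.
  have -> : f * g' - 1 = (f - g) * g' + (g * g' - 1) by ring.
  by rewrite dvdp_add ?dvdp_mulr // (dvdp_trans edm).
pose L f := coprime_lift e m f.
have Le f : e %| L f - f by rewrite /L /coprime_lift addrAC subrr add0r dvdp_mulr.
have Lm f : coprimep f e -> coprimep (L f) m by apply: coprime_liftP.
exists (restr e (X \o L)); last first.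
  apply: funext => f; rewrite /restr; case: (boolP (coprimep f m)) => [fm|/X0] //.
  have fe : coprimep f e by apply: coprimep_dvdl fm.
  by rewrite fe /=; apply: eqX; rewrite ?Lm // -dvdpNr opprB.
split; rewrite /restr.
- by rewrite coprime1p /= ker ?Lm ?coprime1p.
- move=> f g; rewrite coprimepMl; case: (boolP (coprimep f e)) => fe; last by rewrite mul0r.
  case: (boolP (coprimep g e)) => ge; last by rewrite mulr0.
  rewrite /= -XM; apply: eqX; rewrite ?coprimepMl ?Lm ?coprimepMl ?fe //.
  have -> : L (f * g) - L f * L g = (L (f * g) - f * g) - (L f - f) * L g - f * (L g - g).
    by ring.
  by apply: dvdp_sub; [apply: dvdp_sub; rewrite ?dvdp_mulr | rewrite dvdp_mull].
- move=> f; rewrite coprimep_modl; case: ifP => //= fe.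
  apply: eqX; rewrite ?Lm ?coprimep_modl //.
  have -> : L (f %% e) - L f = (L (f %% e) - f %% e) - (L f - f) + (f %% e - f) by ring.
  by apply: dvdp_add; [apply: dvdp_sub | rewrite -eq_modp modp_id].
by move=> f /negPf ->.
Qed.

Lemma primitive_exists m X : m \is monic -> dirichlet m X ->
  exists d Y, [/\ d \is monic, d %| m, primitive_char d Y & X = restr m Y].
Proof.
move: {2}(size m) (leqnn (size m)) => n; elim: n m X => [|n IH] m X.
  by rewrite leqn0 size_poly_eq0 => /eqP -> /monic_neq0; rewrite eqxx.
move=> mn mm Xm; have [Xp|] := pselect (primitive_char m X).
  exists m, X; split=> //.
  apply: funext => f; rewrite /restr; case: Xm => _ _ _ X0.
  by case: ifPn => [|/X0].
rewrite /primitive_char not_andP => -[//|/existsNP [e /not_implyP [em /not_implyP [edm]]]].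
move=> /not_implyP [ker ne].
have [Y Ye XE] := induced_char mm em edm Xm ker.
have se : (size e <= n)%N.
  rewrite -ltnS (leq_trans _ mn) // ltn_neqAle dvdp_leq ?monic_neq0 // andbT.
  by rewrite dvdp_size_eqp //; apply/negP; rewrite eqp_monic // => /eqP.
have [d [Z [dm de Zp YE]]] := IH e Y se em Ye.
exists d, Z; split=> //; first exact: dvdp_trans edm.
rewrite XE YE; apply: funext => f; rewrite /restr; case: ifP => // fm.
by rewrite (coprimep_dvdl edm fm).
Qed.

(** If [f] is 1 modulo the gcd, some [h] is congruent to [f] modulo [d1] and to 1 modulo [d2]; then
    [Y1 f = Y1 h = Y2 h = 1]. So [Y1] is trivial on the units that are 1 modulo the gcd, which
    primitivity forces to be [d1]. *)
Lemma primitive_kernel d1 d2 Y1 Y2 : d1 \is monic -> d2 \is monic ->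
  primitive_char d1 Y1 -> dirichlet d2 Y2 ->
  (forall f, coprimep f d1 -> coprimep f d2 -> Y1 f = Y2 f) ->
  mgcd d1 d2 = d1.
Proof.
move=> m1 m2 [D1 prim] D2 eqY; have [gm g1 g2 ge] := mgcdP d1 (monic_neq0 m2).
apply: prim => // f fd1; rewrite (eqp_dvdl _ ge).
have [[u v] /= uv] := Bezoutp d1 d2; rewrite -(eqp_dvdl _ uv) => /dvdpP [c cE].
have fE : f = 1 + c * (u * d1 + v * d2) by rewrite -cE addrC subrK.
pose h := 1 + c * v * d2.
have hd1 : d1 %| f - h.
  by rewrite (_ : f - h = c * u * d1) ?dvdp_mulIr // fE /h; ring.
have hd2 : d2 %| h - 1 by rewrite /h addrAC subrr add0r dvdp_mulIr.
have h1 : coprimep h d1.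
  by move: hd1; rewrite -eq_modp => /eqP e; rewrite -coprimep_modl -e coprimep_modl.
have h2 : coprimep h d2.
  by move: hd2; rewrite -eq_modp => /eqP e; rewrite -coprimep_modl e coprimep_modl coprime1p.
by rewrite (dirichlet_dvd D1 hd1) eqY // (dirichlet_dvd D2 hd2); case: D2.
Qed.

Lemma primitive_eq d1 d2 Y1 Y2 : d1 \is monic -> d2 \is monic ->
  primitive_char d1 Y1 -> primitive_char d2 Y2 ->
  (forall f, coprimep f d1 -> coprimep f d2 -> Y1 f = Y2 f) ->
  d1 = d2 /\ Y1 = Y2.
Proof.
move=> m1 m2 P1 P2 eqY; have [D1 _] := P1; have [D2 _] := P2.
have e1 := primitive_kernel m1 m2 P1 D2 eqY.
have e2 : mgcd d2 d1 = d2.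
  by apply: primitive_kernel P2 D1 _ => // f f2 f1; rewrite eqY.
have [_ _ + _] := mgcdP d1 (monic_neq0 m2); rewrite e1 => d12.
have [_ _ + _] := mgcdP d2 (monic_neq0 m1); rewrite e2 => d21.
have e : d1 = d2 by apply/eqP; rewrite -eqp_monic //; apply/andP.
by split=> //; move: D2 eqY; rewrite -e => D2 eqY; apply: (dirichlet_ext D1 D2) => f f1; apply: eqY.
Qed.

(** [Y1] times the conjugate of [Y2] is a character modulo [d1 * d2], and the polynomials of size at
    most [L] cover the residues modulo [d1 * d2] evenly. The sum vanishes unless this character is
    principal, that is, unless the two primitive characters agree. *)
Lemma primitive_orth L d1 d2 Y1 Y2 : d1 \is monic -> d2 \is monic ->
  primitive_char d1 Y1 -> primitive_char d2 Y2 -> (deg d1 + deg d2 <= L)%N ->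
  \sum_(f <- polys L) Y1 f * (Y2 f)^* =
  if (d1, Y1) == (d2, Y2) then (#|F| ^ (L - deg d1) * size (units d1))%:R else 0.
Proof.
move=> m1 m2 P1 P2 dL; have [D1 _] := P1; have [D2 _] := P2.
case: eqP => [[_ <-]|ne].
  have dL1 : (deg d1 <= L)%N by rewrite (leq_trans _ dL) // leq_addr.
  have e f : Y1 f * (Y1 f)^* = principal_char C d1 f.
    rewrite -normCK /principal_char /restr; case: (boolP (coprimep f d1)) => fd.
      by rewrite (dirichlet_norm m1 D1 fd) expr1n.
    by case: D1 => _ _ _ /(_ f fd) ->; rewrite normr0 expr0n.
  under eq_bigr do rewrite e.
  rewrite -{1}(subnK dL1) sum_polys_periodic //.
    by rewrite sum_principal -mulrnA mulnC.
  by move=> f; apply: restr_periodic.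
have D12 := dirichlet_mul_conj D1 D2.
have m12 : d1 * d2 \is monic by rewrite monicMl.
rewrite -(subnK dL) -(degM m1 m2).
rewrite (@sum_polys_periodic F C (d1 * d2) _ (fun f => Y1 f * (Y2 f)^*)) //; last by case: D12.
rewrite (sum_nonprincipal m12 D12) ?mul0rn //.
apply/eqP => pr; apply: ne; suff [-> ->] : d1 = d2 /\ Y1 = Y2 by [].
apply: primitive_eq => // f f1 f2.
have := congr1 (@^~ f) pr; rewrite /principal_char /restr coprimepMr f1 f2 /= => e.
have y0 := dirichlet_neq0 D2 f2.
have : (Y2 f)^* * Y2 f = 1 by rewrite mulrC -normCK (dirichlet_norm m2 D2 f2) expr1n.
by move=> e'; apply: (@mulIf _ (Y2 f)^*); rewrite ?conjC_eq0 // e mulrC e'.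
Qed.

Definition prim_chars d := [seq Y <- chars C d | `[< primitive_char d Y >]].

Lemma mem_prim_chars d Y : d \is monic -> Y \in prim_chars d <-> primitive_char d Y.
Proof.
move=> dm; rewrite mem_filter; split=> [/andP [/asboolP //]|P].
by rewrite asboolT //=; apply/mem_chars => //; case: P.
Qed.

Lemma prim_chars_uniq d : d \is monic -> uniq (prim_chars d).
Proof. by move=> dm; rewrite filter_uniq //; case: (charsP C dm). Qed.

Lemma primitive_nonprincipal d Y : d \is monic -> (0 < deg d)%N -> primitive_char d Y ->
  Y != principal_char C d.
Proof.
move=> dm d0 [_ prim]; apply/eqP => e; have := prim 1 (monic1 _) (dvd1p _).
move=> H; suff : 1 = d by move=> d1; move: d0; rewrite -d1 /deg size_poly1.
by apply: H => f fd _; rewrite e /principal_char /restr fd.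
Qed.

(* Bessel's inequality for the primitive characters with conductor of degree j:
   these are exactly orthogonal on the polynomials of size at most L >= 2 j. *)
Lemma large_sieve j n (c : {poly F} -> C) :
  \sum_(d <- mpolys j) (size (units d))%:R^-1 *
     \sum_(Y <- prim_chars d) `|\sum_(f <- mpolys n) c f * Y f| ^+ 2
  <= (#|F| ^ (maxn n.+1 (2 * j) - j))%:R * \sum_(f <- mpolys n) `|c f| ^+ 2.
Proof.
set L := maxn _ _; have jL : (j + j <= L)%N by rewrite addnn -mul2n leq_maxr.
have jL' : (j <= L)%N by rewrite (leq_trans (leq_addr _ _) jL).
have q0 : (0 < #|F| ^ (L - j))%N by rewrite expn_gt0 ltnW // card_finNzRing_gt1.
pose r := [seq (d, Y) | d <- mpolys j, Y <- prim_chars d].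
pose c' f := if f \in mpolys n then c f else 0.
have extend (V : nmodType) (G : {poly F} -> V) :
    \sum_(f <- polys L) (if f \in mpolys n then G f else 0) = \sum_(f <- mpolys n) G f.
  rewrite -big_mkcond -big_filter; apply: perm_big; apply: uniq_perm.
  - by rewrite filter_uniq ?polys_uniq.
  - exact: mpolys_uniq.
  move=> f; rewrite mem_filter mem_polys andb_idr // => /mpolysP [_ ->].
  exact: leq_maxl.
(* The square norm from [primitive_orth]; [maxn 1] only makes it positive at indices outside [r]
   too, as [bessel] asks. *)
pose w (i : {poly F} * ({poly F} -> C)) : C :=
  (#|F| ^ (L - j) * maxn 1 (size (units i.1)))%:R.
have mr i : i \in r -> [/\ i.1 \is monic, deg i.1 = j & primitive_char i.1 i.2].
  case/allpairsPdep => d [Y [/mpolysP [dm ds] + ->]] /=.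
  by rewrite /deg ds => /mem_prim_chars - /(_ dm).
have ur : uniq r.
  apply: allpairs_uniq_dep; first exact: mpolys_uniq.
    by move=> d /mpolysP [dm _]; apply: prim_chars_uniq.
  by move=> [d Y] [d' Y'] _ _ /= [-> ->].
have := @bessel C _ (polys L) _ r (fun i => i.2) w c' ur.
have -> : \sum_(f <- polys L) `|c' f| ^+ 2 = \sum_(f <- mpolys n) `|c f| ^+ 2.
  rewrite -extend; apply: eq_bigr => f _; rewrite /c'.
  by case: ifP => // _; rewrite normr0 expr0n.
move=> H; rewrite mulrC -ler_pdivrMr ?ltr0n //; apply: le_trans (H _ _); last first.
- move=> i i' ir ir'; have [im id ip] := mr i ir; have [im' id' ip'] := mr i' ir'.
  rewrite (@primitive_orth L i.1 i'.1) ?id ?id' // -!surjective_pairing.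
  by rewrite /w (maxn_idPr _) // units_gt0.
- by move=> i; rewrite /w ltr0n muln_gt0 q0 leq_max.
rewrite big_allpairs_dep /= mulr_suml !big_seq; apply: ler_sum => d dj.
case/mpolysP: dj => dm ds; rewrite mulr_sumr mulr_suml le_eqVlt; apply/orP; left.
apply/eqP; apply: eq_bigr => Y _; rewrite /w /= (maxn_idPr _) ?units_gt0 // natrM.
rewrite invfM mulrC mulrA; congr (_ * `|_| ^+ 2).
rewrite -extend; apply: eq_bigr => f _; rewrite /c'.
by case: ifP => // _; rewrite mul0r.
Qed.

End PrimitiveCharacters.

(** * Divisor functions *)

Section Tau.
Variables (F : finFieldType).
Implicit Types (d e f g h l m r : {poly F}) (n a b k : nat).
Local Notation polys := (polys F).
Local Notation mpolys := (mpolys F).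

(** The size of [f] occurs in the type of its factors; a fixed [s] puts the factorizations of all
    [f] of one degree into a single type. *)
Lemma tauE k f s : size f = s ->
  tau k f = #|[set g : {ffun 'I_k -> {poly_s F}} |
    [forall i, (g i : {poly F}) \is monic] && (\prod_i (g i : {poly F}) == f)]|.
Proof. by move=> <-. Qed.

Lemma deg_prod_monic (I : finType) (g : I -> {poly F}) :
  (forall i, g i \is monic) ->
  \prod_i g i \is monic /\ deg (\prod_i g i) = (\sum_i deg (g i))%N.
Proof.
move=> gm; apply: (big_rec2 (fun p n => p \is monic /\ deg p = n)).
  by rewrite monic1 /deg size_poly1.
by move=> i n p _ [pm <-]; rewrite monicMl // degM.
Qed.

Lemma mem_mpolys_deg n f : (f \in mpolys n) = (f \is monic) && (deg f == n).
Proof.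
rewrite mem_mpolys; case: (boolP (f \is monic)) => //= fm.
by rewrite (monic_size fm) eqSS.
Qed.

Definition chsum (V : nmodType) n (X : {poly F} -> V) : V := \sum_(f <- mpolys n) X f.

Lemma sum_tau (C : comNzRingType) k M (X : {poly F} -> C) :
  X 1 = 1 -> {morph X : f g / f * g} ->
  \sum_(f <- mpolys M) (tau k f)%:R * X f =
  \sum_(n : {ffun 'I_k -> 'I_M.+1} | (\sum_i n i == M)%N) \prod_i chsum (n i) X.
Proof.
move=> X1 XM.
pose P (g : {ffun 'I_k -> {poly_M.+1 F}}) :=
  [forall i, (g i : {poly F}) \is monic] && (\prod_i (g i : {poly F}) \in mpolys M).
transitivity (\sum_(g | P g) \prod_i X (g i)).
  transitivity (\sum_(f <- mpolys M)
     \sum_(g : {ffun 'I_k -> {poly_M.+1 F}} |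
        [forall i, (g i : {poly F}) \is monic] && (\prod_i (g i : {poly F}) == f)) X f).
    apply: eq_big_seq => f /mpolysP [_ sf].
    by rewrite (tauE _ sf) sumr_const mulr_natl cardsE.
  rewrite (exchange_big_dep (fun g : {ffun 'I_k -> {poly_M.+1 F}} => [forall i, (g i : {poly F}) \is monic])) /=; last first.
    by move=> f g _ /andP [].
  rewrite [LHS]big_mkcond [RHS]big_mkcond; apply: eq_bigr => g _; rewrite /P.
  case: (boolP [forall i, _]) => //= gm.
  rewrite -(big_morph X XM X1).
  case: (boolP (_ \in _)) => [im|nim].
    rewrite big_mkcond (bigD1_seq _ im) ?mpolys_uniq //= eqxx [X in _ + X]big1 ?addr0 // => f.
    by rewrite eq_sym => /negPf ->.
  rewrite big1_seq // => f /andP [/eqP <- /= im].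
  by rewrite im in nim.
(* Sort the tuples of factors by their degrees; these are at most [M], so [inord] loses nothing. *)
rewrite (partition_big (fun g : {ffun 'I_k -> {poly_M.+1 F}} => [ffun i => inord (deg (g i))])
   (fun n : {ffun 'I_k -> 'I_M.+1} => (\sum_i n i == M)%N)) /=; last first.
  move=> g /andP [/forallP gm]; have [_ dE] := deg_prod_monic gm.
  rewrite mem_mpolys_deg dE => /andP [_ /eqP dM]; apply/eqP; rewrite -[RHS]dM; apply: eq_bigr => i _.
  by rewrite ffunE inordK // ltnS /deg -ltnS (leq_trans _ (size_npoly (g i))) // ltn_predL size_poly_gt0 monic_neq0.
apply: eq_bigr => n nM.
have chE a : (a < M.+1)%N -> chsum a X = \sum_(p : {poly_M.+1 F} | (p : {poly F}) \in mpolys a) X p.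
  move=> aM; rewrite /chsum; transitivity (\sum_(f <- polys M.+1 | f \in mpolys a) X f).
  rewrite -[RHS]big_filter.
  apply: perm_big; apply: uniq_perm; rewrite ?mpolys_uniq ?filter_uniq ?polys_uniq //.
  move=> f; rewrite [RHS]mem_filter mem_polys andb_idr // => /mpolysP [_ ->].
    exact: aM.
  by rewrite big_map big_enum_cond.
under [RHS]eq_bigr do rewrite chE //.
rewrite bigA_distr_big_dep; apply: eq_bigl => g; apply/andP/familyP.
  case=> /andP [/forallP gm _] /eqP <- i; rewrite ffunE unfold_in /= mem_mpolys_deg gm /=.
  by rewrite inordK // ltnS /deg -ltnS (leq_trans _ (size_npoly (g i))) // ltn_predL size_poly_gt0 monic_neq0.
move=> H; have gm i : (g i : {poly F}) \is monic.
  by have := H i; rewrite unfold_in /= mem_mpolys_deg => /andP [].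
have gd i : deg (g i) = n i.
  by have := H i; rewrite unfold_in /= mem_mpolys_deg => /andP [_ /eqP].
have [pm pd] := deg_prod_monic gm.
split; last by apply/eqP/ffunP => i; rewrite ffunE gd inord_val.
rewrite /P mem_mpolys_deg pm pd (eq_bigr _ (fun i _ => gd i)) nM !andbT.
exact/forallP.
Qed.

Lemma card_divs f : #|[set p : {poly_(size f) F} | (val p \is monic) && (val p %| f)]| = dv f.
Proof.
by rewrite /dv /divs -sum1_card -[RHS]sum1_size big_filter big_map big_enum_cond; apply: eq_bigl => p; rewrite inE.
Qed.

Lemma tau_le_dv k f : f \is monic -> (tau k f <= dv f ^ k)%N.
Proof.
move=> fm; rewrite -card_divs -[X in (_ <= _ ^ X)%N]card_ord -card_ffun_on.
apply: subset_leq_card; apply/subsetP => g; rewrite inE => /andP [/forallP gm /eqP gf].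
apply/ffun_onP => i; rewrite inE gm /=.
by rewrite -[X in _ %| X]gf (bigD1 i) //= dvdp_mulr.
Qed.

Lemma dv_le_tau2 f : f \is monic -> (dv f <= tau 2 f)%N.
Proof.
move=> fm; rewrite -card_divs.
pose p2 (p : {poly_(size f) F}) : {ffun 'I_2 -> {poly_(size f) F}} :=
  [ffun i => if i == ord0 then p else npolyp (size f) (f %/ p)].
have inj : injective p2 by move=> p p' /ffunP /(_ ord0); rewrite !ffunE eqxx.
rewrite -(card_imset _ inj); apply: subset_leq_card; apply/subsetP => _ /imsetP [p + ->].
rewrite !inE => /andP [pm pf].
have pE : npolyp (size f) (f %/ p) = f %/ p :> {poly F} by rewrite npolypK // leq_divp.
apply/andP; split; last by rewrite 2!big_ord_recl big_ord0 !ffunE /= pE mulr1 mulrC divpK.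
apply/forallP => i; rewrite ffunE; case: ifP => // _; rewrite pE.
by rewrite -(monicMr _ pm) divpK.
Qed.

(** [b f] counts the factorizations of [f] with degrees [s]. It is chosen before [X]: the large
    sieve needs the same coefficients for all characters. *)
Lemma prod_chsum (s : seq nat) :
  exists b : {poly F} -> nat, (forall f, f \is monic -> b f <= dv f ^ size s)%N /\
  forall (C : comNzRingType) (X : {poly F} -> C), X 1 = 1 -> {morph X : f g / f * g} ->
    \prod_(n <- s) chsum n X = \sum_(f <- mpolys (sumn s)) (b f)%:R * X f.
Proof.
elim: s => [|n s [b [bd bE]]].
  exists (fun=> 1%N); split=> // C X X1 _.
  by rewrite big_nil (perm_big _ (mpolys0 F)) big_seq1 X1 mul1r.
exists (fun f => \sum_(g <- divs f | deg g == n) b (f %/ g)%R)%N; split.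
  move=> f fm; have f0 := monic_neq0 fm.
  rewrite /= expnS {1}/dv -sum1_size big_distrl /= big_mkcond /= big_seq [X in (_ <= X)%N]big_seq.
  apply: leq_sum => g; rewrite mem_divs // => /andP [gm gf]; rewrite mul1n.
  case: ifP => // _; apply: (leq_trans (bd _ _)); first by rewrite -(monicMr _ gm) divpK.
  by apply: leq_expl; apply: dv_dvd => //; apply: divp_dvd.
move=> C X X1 XM; rewrite big_cons (bE C X) //=.
transitivity (\sum_(f <- mpolys (n + sumn s)) \sum_(g <- divs f)
    (if deg g == n then (b (f %/ g))%:R * (X g * X (f %/ g)) else 0)).
  rewrite (sum_dirichlet_conv (n + sumn s) (fun g h =>
    if deg g == n then (b h)%:R * (X g * X h) else 0)).
  have nlt : (n < (n + sumn s).+1)%N by rewrite ltnS leq_addr.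
  rewrite (bigD1 (Ordinal nlt)) //= addKn [X in _ + X]big1 ?addr0 => [|a na].
    rewrite /chsum big_distrl /=; apply: eq_big_seq => g; rewrite mem_mpolys_deg => /andP [_ ->].
    by rewrite mulr_sumr; apply: eq_bigr => h _; ring.
  rewrite big1_seq // => g /andP [_]; rewrite mem_mpolys_deg => /andP [_ /eqP ->].
  by rewrite big1 // => h _; move: na; rewrite -val_eqE /= => /negPf ->.
apply: eq_big_seq => f /mpolysP [fm _]; have f0 := monic_neq0 fm.
rewrite natr_sum mulr_suml [RHS]big_mkcond; apply: eq_big_seq => g.
rewrite mem_divs // => /andP [gm gf]; case: ifP => // _.
by rewrite -XM [g * _]mulrC divpK.
Qed.

(** A monic divisor [p] of least size above 1 is irreducible, since a gcd with it is either constant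
    or [p] itself. Induction then applies to [gdcop p m], the part of [m] coprime to [p]. *)
Lemma prime_list m : m != 0 -> exists S : seq {poly F},
  [/\ uniq S, (size S <= deg m)%N,
      {in S, forall p, [/\ p \is monic, (0 < deg p)%N, p %| m &
                        forall f, ~~ coprimep f p -> p %| f]}
    & forall f, coprimep f m = all (coprimep f) S].
Proof.
move: {2}(size m) (leqnn (size m)) => n; elim: n m => [|n IH] m.
  by rewrite leqn0 size_poly_eq0 => /eqP -> /eqP.
move=> mn m0; case: (leqP (size m) 1) => [sm|sm].
  exists [::]; split=> // f; have /size_poly1P [c c0 ->] : size m == 1%N.
    by rewrite eqn_leq sm size_poly_gt0.
  by rewrite -[c%:P]mulr1 mul_polyC coprimepZr // coprimep1.
pose Q a := (1 < a)%N && has (fun p : {poly F} => size p == a) (divs m).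
have exQ : exists a, Q a.
  exists (size m); rewrite /Q sm; apply/hasP; exists ((lead_coef m)^-1 *: m).
    by rewrite mem_divs // monicE lead_coefZ mulVf ?lead_coef_eq0 // dvdpZl ?invr_eq0 ?lead_coef_eq0 ?dvdpp // eqxx.
  by rewrite size_scale // invr_eq0 lead_coef_eq0.
case: (ex_minnP exQ) => a /andP [a1 /hasP [p]]; rewrite mem_divs // => /andP [pm pdm] /eqP pa amin.
have p0 := monic_neq0 pm.
have irr f : ~~ coprimep f p -> p %| f.
  move=> nc; have [gm gf gp ge] := mgcdP f p0.
  have /amin : Q (size (mgcd f p)).
    apply/andP; split; last by apply/hasP; exists (mgcd f p) => //; rewrite mem_divs // gm (dvdp_trans gp).
    rewrite ltn_neqAle size_poly_gt0 monic_neq0 // andbT eq_sym (eqp_size ge).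
    exact: nc.
  rewrite -pa => le; have : mgcd f p %= p by rewrite -(dvdp_size_eqp gp) eqn_leq le dvdp_leq.
  by move=> /eqp_dvdl e; rewrite -e.
pose m' := gdcop p m.
have m'm : m' %| m by apply: dvdp_gdco.
have m'0 : m' != 0 by apply: dvdpN0 m'm m0.
have cop : coprimep m' p by apply: coprimep_gdco.
have mul : m' * p %| m by rewrite Gauss_dvdp // m'm.
have szle : (size m' + deg p <= size m)%N.
  by have := dvdp_leq m0 mul; rewrite size_mul // (monic_size pm) addnS.
have dp : (0 < deg p)%N by rewrite -ltnS -(monic_size pm) pa.
have [|//|S [uS sS HS cS]] := IH m'.
  by rewrite -ltnS (leq_trans _ mn) // (leq_trans _ szle) // -addn1 leq_add2l.
exists (p :: S); split.
- rewrite /= uS andbT; apply/negP => /HS [_ _ pm' _].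
  have := coprimep_dvdr pm' cop; rewrite coprimepp pa.
  by case: a a1 {amin pa} => [|[]].
- rewrite /= (leq_ltn_trans sS) // -ltnS /deg !prednK ?size_poly_gt0 //.
  by rewrite (leq_trans _ szle) // -addn1 leq_add2l.
- move=> g; rewrite inE => /orP [/eqP -> //|/HS [gm gd gm' gi]]; split=> //.
  exact: dvdp_trans m'm.
move=> f; rewrite /= -cS; apply/idP/andP => [fm|[fp fm']].
  by rewrite (coprimep_dvdl pdm fm) (coprimep_dvdl m'm fm).
apply: (coprimep_dvdl (dvdp_gdcor m p0)).
by rewrite coprimepMr fm' coprimep_expr.
Qed.

End Tau.

(** * Character sums with a small conductor *)

Section ComplexAbs.
Variable R : realType.
Implicit Types z t : R[i].

Lemma normc_cabs z : `|z| = (cabs z)%:C%C.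
Proof. by []. Qed.

Lemma cabs_ge0 z : 0 <= cabs z.
Proof. by rewrite -lecR -normc_cabs normr_ge0. Qed.

Lemma cabsM z t : cabs (z * t) = cabs z * cabs t.
Proof. exact: Normc.normcM. Qed.

Lemma cabs_le z (x : R) : (`|z| <= x%:C%C) = (cabs z <= x).
Proof. by rewrite normc_cabs lecR. Qed.

Lemma cabsD z t : cabs (z + t) <= cabs z + cabs t.
Proof. by rewrite -cabs_le rmorphD /= -!normc_cabs ler_normD. Qed.

Lemma cabsN z : cabs (- z) = cabs z.
Proof. by apply: (@complexI R); rewrite -!normc_cabs normrN. Qed.

Lemma cabs0 : cabs (0 : R[i]) = 0.
Proof. by apply: (@complexI R); rewrite -normc_cabs normr0. Qed.

Lemma cabs_nat n : cabs (n%:R : R[i]) = n%:R.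
Proof. by apply: (@complexI R); rewrite -normc_cabs normr_nat rmorph_nat. Qed.

Lemma cabs_natV n : cabs ((n%:R : R[i])^-1) = n%:R^-1.
Proof. by rewrite /cabs Normc.normcV -/(cabs _) cabs_nat. Qed.

Lemma cabs_sum (I : Type) (s : seq I) (P : pred I) (f : I -> R[i]) :
  cabs (\sum_(i <- s | P i) f i) <= \sum_(i <- s | P i) cabs (f i).
Proof.
elim/big_ind2: _ => //; first by rewrite cabs0.
by move=> a x b y ax ay; apply: le_trans (cabsD _ _) (lerD ax ay).
Qed.

Lemma cabs_prod (I : Type) (s : seq I) (P : pred I) (f : I -> R[i]) :
  cabs (\prod_(i <- s | P i) f i) = \prod_(i <- s | P i) cabs (f i).
Proof.
apply: (big_morph _ cabsM).
by rewrite -[1]/(1%:R) cabs_nat.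
Qed.

End ComplexAbs.

Section Decay.
Variable R : realType.

(** Split [rho] as a square [s ^+ 2]: one half handles the exponent [a], and the other absorbs one
    more factor [N.+1], since [N.+1 * s ^ N] is at most the geometric sum. *)
Lemma poly_decay (rho : R) a : 0 < rho < 1 ->
  exists2 K : R, 0 < K & forall N, (N.+1%:R) ^+ a * rho ^+ N <= K.
Proof.
elim: a rho => [|a IH] rho /andP [r0 r1].
  by exists 1 => // N; rewrite expr0 mul1r exprn_ile1 // ltW.
pose s := Num.sqrt rho.
have s0 : 0 < s by rewrite sqrtr_gt0.
have s2 : s ^+ 2 = rho by rewrite sqr_sqrtr // ltW.
have s1 : s < 1 by rewrite -(@ltr_pXn2r _ 2) ?nnegrE ?ltW // s2 expr1n.
have [|K K0 HK] := IH s; first by rewrite s0.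
have K1 N : N.+1%:R * s ^+ N <= (1 - s)^-1.
  rewrite -[_^-1]mul1r ler_pdivlMr ?subr_gt0 //.
  have : (1 - s) * (\sum_(i < N.+1) s ^+ i) = 1 - s ^+ N.+1.
    by rewrite -[1 in RHS](expr1n _ N.+1) subrXX; congr (_ * _); apply: eq_bigr => i _; rewrite expr1n mul1r.
  move=> e; apply: (@le_trans _ _ (1 - s ^+ N.+1)); last by rewrite gerBl exprn_ge0 // ltW.
  rewrite -e mulrC ler_pM2l ?subr_gt0 //.
  have -> : N.+1%:R * s ^+ N = \sum_(i < N.+1) s ^+ N by rewrite sumr_const card_ord mulr_natl.
  apply: ler_sum => i _; apply: ler_wiXn2l; rewrite ?ltW //.
  by rewrite -ltnS.
exists (K * (1 - s)^-1); first by rewrite mulr_gt0 // invr_gt0 subr_gt0.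
move=> N; rewrite -s2 -exprM mulnC exprM exprSr expr2.
rewrite (_ : _ * _ = (N.+1%:R ^+ a * s ^+ N) * (N.+1%:R * s ^+ N)); last by ring.
by rewrite ler_pM // mulr_ge0 ?exprn_ge0 // ltW.
Qed.

Lemma powR_natS (N a : nat) (D : R) : (0 < N)%N -> D <= a%:R -> N%:R `^ D <= N.+1%:R ^+ a.
Proof.
move=> N0 Da; apply: (@le_trans _ _ (N%:R `^ a%:R)).
  by rewrite ler_powR // ler1n.
by rewrite powR_mulrn // lerXn2r ?nnegrE // ler_nat.
Qed.

End Decay.

Section Sieve.
Variables (F : finFieldType) (R : realType).
Local Notation C := R[i].
Local Notation q := (#|F|).
Implicit Types (d e f g h l m r p : {poly F}) (n a b k : nat) (X Y : {poly F} -> C).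
Local Notation polys := (polys F).
Local Notation mpolys := (mpolys F).

Lemma card_field_gt1 : (1 < q)%N.
Proof. exact: card_finNzRing_gt1. Qed.

(** The sum vanishes from degree [deg d] on; below it the trivial bound is used. *)
Lemma chsum_nonprincipal_le d Y n : d \is monic -> dirichlet d Y ->
  Y != principal_char C d -> cabs (chsum n Y) <= q%:R ^+ deg d.
Proof.
move=> dm Yd nY; have q1 := card_field_gt1; case: (leqP (deg d) n) => dn.
  rewrite /chsum -(subnK dn) (@sum_mpolys_periodic F C d) //; last by case: Yd.
  by rewrite (sum_nonprincipal dm Yd nY) mul0rn cabs0 exprn_ge0.
apply: le_trans (cabs_sum _ _ _) _.
apply: (@le_trans _ _ (\sum_(f <- mpolys n) 1)).
  by apply: ler_sum => f _; rewrite -cabs_le; apply: dirichlet_norm_le1 dm Yd.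
rewrite sum_const_seq size_mpolys natrX; apply: ler_weXn2l; last exact: ltnW.
by rewrite ler1n ltnW.
Qed.

(* One irreducible at a time: among the f coprime to the irreducibles in s, those
   divisible by p are the p * h, and Y is multiplicative. *)
Lemma sieve_step d Y (s : seq {poly F}) (y c : R) : d \is monic -> dirichlet d Y ->
  0 < y -> 0 <= c ->
  (forall n, cabs (chsum n Y) <= c * y ^+ n) ->
  {in s, forall p, [/\ p \is monic, (0 < deg p)%N & forall f, ~~ coprimep f p -> p %| f]} ->
  forall n, cabs (chsum n (fun f => if all (coprimep f) s then Y f else 0))
    <= c * y ^+ n * \prod_(p <- s) (1 + y ^- deg p).
Proof.
move=> dm Yd y0 c0 base; have [Y1 YM _ _] := Yd.
elim: s => [|p s IH] Hs n.
  by rewrite big_nil mulr1; exact: base.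
have [pm dp pirr] := Hs p (mem_head _ _).
have Hs' : {in s, forall p, [/\ p \is monic, (0 < deg p)%N & forall f, ~~ coprimep f p -> p %| f]}.
  by move=> x xs; apply: Hs; rewrite inE xs orbT.
have {IH} IH := IH Hs'.
pose X f := if all (coprimep f) s then Y f else 0.
have XM f g : X (f * g) = X f * X g.
  rewrite /X (_ : all (coprimep (f * g)) s = all (coprimep f) s && all (coprimep g) s).
    by case: all; case: all; rewrite ?mulr0 ?mul0r //= YM.
  by rewrite -all_predI; apply: eq_all => x; rewrite /= coprimepMl.
have X1 f : cabs (X f) <= 1.
  rewrite /X; case: ifP => _; last by rewrite cabs0 ler01.
  by rewrite -cabs_le; apply: dirichlet_norm_le1 dm Yd.
have irrE f : coprimep f p = ~~ (p %| f).
  apply/idP/idP => [fp|]; last by apply: contraR => /pirr.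
  apply/negP => pf; have := coprimep_dvdr pf fp; rewrite coprimepp (monic_size pm) eqSS.
  by move/eqP => e; rewrite e in dp.
have -> : chsum n (fun f => if all (coprimep f) (p :: s) then Y f else 0)
    = chsum n X - \sum_(f <- mpolys n | p %| f) X f.
  rewrite /chsum [X in _ - X]big_mkcond -sumrB; apply: eq_bigr => f _ /=.
  by rewrite irrE /X; case: (p %| f) => /=; rewrite ?subrr ?subr0.
apply: le_trans (cabsD _ _) _; rewrite cabsN big_cons.
rewrite mulrCA mulrDl mul1r; apply: lerD; first exact: IH.
have [pn|np] := leqP (deg p) n; last first.
  rewrite big1_seq ?cabs0 => [|f /andP [pf /mpolysP [fm fs]]].
    rewrite mulr_ge0 ?invr_ge0 ?exprn_ge0 ?mulr_ge0 ?exprn_ge0 // ?ltW //.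
    by apply: prodr_gt0 => x _; rewrite ltr_wpDr ?ltr01 // invr_ge0 exprn_ge0 // ltW.
  have := dvdp_leq (monic_neq0 fm) pf.
  by rewrite fs (monic_size pm) ltnS leqNgt np.
have nE : mpolys n = mpolys (deg p + (n - deg p)) by rewrite subnKC.
rewrite -[X in cabs X]big_filter nE (perm_big _ (mpolys_dvdE _ (monic_mpolys pm))) big_map.
under eq_bigr do rewrite XM.
rewrite -mulr_sumr cabsM; apply: le_trans (ler_wpM2r (cabs_ge0 _) (X1 p)) _.
rewrite mul1r; apply: le_trans (IH _) _.
rewrite -[in y ^+ n](subnKC pn) exprD le_eqVlt; apply/orP; left; apply/eqP.
by field; rewrite expf_neq0 // gt_eqF.
Qed.

Lemma sieve_bound d Y m (y : R) : d \is monic -> dirichlet d Y ->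
  Y != principal_char C d -> m != 0 -> 1 <= y ->
  exists s : seq {poly F}, [/\ uniq s, (size s <= deg m)%N, {in s, forall p, p \is monic}
   & forall n, cabs (chsum n (restr m Y)) <=
       q%:R ^+ deg d * y ^+ n * \prod_(p <- s) (1 + y ^- deg p)].
Proof.
move=> dm Yd nY m0 y1; have [s [us ss Hs cs]] := prime_list m0.
exists s; split=> // [p /Hs [] //|n].
have -> : chsum n (restr m Y) = chsum n (fun f => if all (coprimep f) s then Y f else 0).
  by apply: eq_bigr => f _; rewrite /restr cs.
apply: (sieve_step dm Yd); rewrite ?exprn_ge0 ?(lt_le_trans ltr01) //.
  move=> n'; apply: le_trans (chsum_nonprincipal_le n' dm Yd nY) _.
  by rewrite ler_peMr ?exprn_ge0 // exprn_ege1.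
by move=> p /Hs [].
Qed.

(** Up to degree [b], count all monic polynomials; beyond it, each of the at most [size s] terms is
    below [y ^- b]. *)
Lemma sum_deg_le (y : R) (s : seq {poly F}) b : 1 <= y -> uniq s ->
  {in s, forall p, p \is monic} ->
  \sum_(p <- s) y ^- deg p <= \sum_(a < b.+1) (q%:R / y) ^+ a + (size s)%:R * y ^- b.
Proof.
move=> y1 us Hs; have y0 : 0 < y := lt_le_trans ltr01 y1.
rewrite (bigID (fun p => deg p <= b)%N) /=; apply: lerD; last first.
  apply: (@le_trans _ _ (\sum_(p <- s | ~~ (deg p <= b)%N) y ^- b)).
    apply: ler_sum => p; rewrite -ltnNge => bp.
    by rewrite lef_pV2 ?posrE ?exprn_gt0 // ler_weXn2l // ltnW.
  apply: (@le_trans _ _ (\sum_(p <- s) y ^- b)).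
    rewrite [X in X <= _]big_mkcond; apply: ler_sum => p _; case: ifP => // _.
    by rewrite invr_ge0 exprn_ge0 // ltW.
  by rewrite sum_const_seq mulr_natl.
rewrite (_ : \sum_(p <- s | _) _ =
    \sum_(a < b.+1) \sum_(p <- s | deg p == a) y ^- deg p); last first.
  rewrite (exchange_big_dep predT) //= [LHS]big_mkcond; apply: eq_bigr => p _.
  case: (leqP (deg p) b) => pb.
    by rewrite (big_pred1 (Ordinal (pb : (deg p < b.+1)%N))) // => i; rewrite -val_eqE eq_sym.
  rewrite big1 // => i /eqP e; have := ltn_ord i.
  by rewrite -e ltnS leqNgt pb.
apply: ler_sum => a _; rewrite -big_filter expr_div_n.
rewrite (eq_big_seq (fun=> y ^- a)) => [|p]; last by rewrite mem_filter => /andP [/eqP ->].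
rewrite sum_const_seq -[X in X <= _]mulr_natl ler_wpM2r ?invr_ge0 ?exprn_ge0 ?(ltW y0) //.
rewrite -natrX ler_nat -size_mpolys; apply: uniq_leq_size; first exact: filter_uniq.
move=> p; rewrite mem_filter => /andP [/eqP e /Hs pm].
by rewrite mem_mpolys_deg pm e eqxx.
Qed.

End Sieve.

Lemma up_log_le q n : (1 < q)%N -> (0 < n)%N -> (q ^ up_log q n <= q * n)%N.
Proof.
move=> q1; rewrite leq_eqVlt => /orP [/eqP <-|n1]; first by rewrite up_log1 muln1 ltnW.
have /andP [lo _] := up_log_bounds q1 n1.
have b0 : (0 < up_log q n)%N by rewrite up_log_gt0 q1.
by rewrite -(prednK b0) expnS leq_mul2l ltnW ?orbT.
Qed.

(** * Rankin's trick and the exponential saving for a fixed conductor *)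

Section Rankin.
Variables (F : finFieldType) (R : realType).
Local Notation C := R[i].
Local Notation q := (#|F|).
Implicit Types (d e f g h l m r p : {poly F}) (n a b k : nat) (X Y : {poly F} -> C).

Lemma bernoulli_exp (w : R) b : 1 <= w -> 1 + b%:R * (w - 1) <= w ^+ b.
Proof.
move=> w1; elim: b => [|b IH]; first by rewrite mul0r addr0 expr0.
rewrite exprS; apply: (@le_trans _ _ (w * (1 + b%:R * (w - 1)))); last first.
  by rewrite ler_wpM2l // (le_trans ler01).
rewrite -natr1 -subr_ge0.
have -> : w * (1 + b%:R * (w - 1)) - (1 + (b%:R + 1) * (w - 1)) = b%:R * (w - 1) ^+ 2 by ring.
by rewrite mulr_ge0 // sqr_ge0.
Qed.

(* The count splits at degree b with q ^ b about N ^ kappa; the resulting bound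
   v satisfies v ^ (kappa + 1) <= q * N ^ kappa, so it is o(N). *)
Lemma rankin (kappa : nat) (w eps : R) : 1 < w -> w ^+ (2 * kappa.+1) = q%:R -> 0 < eps ->
  exists2 K : R, 0 <= K & forall N, (0 < N)%N -> forall s : seq {poly F}, uniq s ->
    {in s, forall p, p \is monic} -> (size s <= N ^ kappa)%N ->
    \sum_(p <- s) (q%:R / w) ^- deg p <= eps * N%:R + K.
Proof.
move=> w1 wq eps0; have w0 : 0 < w by lra.
have q1 := card_field_gt1 F; have q0 : (0 : R) < q%:R by rewrite ltr0n ltnW.
have y1 : 1 <= q%:R / w.
  by rewrite ler_pdivlMr // mul1r -wq -[X in X <= _]expr1 ler_weXn2l ?ltW.
have qy : q%:R / (q%:R / w) = w by rewrite invf_div mulrCA divff ?mulr1 // gt_eqF.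
(* By Bernoulli's inequality [b <= w ^ b / (w - 1)], so [(b + 2) * w ^ b] is at most
   [c * w ^ (2 * b)], which is [c * v]. *)
pose c := 2 + (w - 1)^-1; have c0 : 0 < c.
  by rewrite /c addr_gt0 // invr_gt0 subr_gt0.
pose delta := eps / c; have delta0 : 0 < delta by rewrite divr_gt0.
exists (c * (q%:R / delta ^+ kappa)).
  by rewrite mulr_ge0 ?(ltW c0) // divr_ge0 ?(ltW q0) // exprn_ge0 // ltW.
move=> N N0 s us Hs ss; pose b := up_log q (N ^ kappa).
have Nk0 : (0 < N ^ kappa)%N by rewrite expn_gt0 N0.
pose v := w ^+ b * w ^+ b; have wb0 : 0 < w ^+ b by rewrite exprn_gt0.
have v0 : 0 < v by rewrite mulr_gt0.
have vk : v ^+ kappa.+1 <= q%:R * N%:R ^+ kappa.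
  rewrite /v -exprD -exprM addnn -mul2n -mulnA mulnCA mulnC exprM -[X in (w ^+ X) ^+ _]/(2 * kappa.+1)%N wq.
  by rewrite -!natrX -natrM ler_nat up_log_le.
apply: (@le_trans _ _ (c * v)).
  apply: le_trans (sum_deg_le b y1 us Hs) _; rewrite qy.
  have h1 : \sum_(a < b.+1) w ^+ a <= b.+1%:R * w ^+ b.
    rewrite (_ : b.+1%:R * _ = \sum_(a < b.+1) w ^+ b); last first.
      by rewrite sumr_const card_ord mulr_natl.
    by apply: ler_sum => a _; rewrite ler_weXn2l ?(ltW w1) // -ltnS.
  have h2 : (size s)%:R * (q%:R / w) ^- b <= w ^+ b.
    rewrite -{2}qy [(_ / (_ / _)) ^+ b]expr_div_n ler_wpM2r ?invr_ge0 ?exprn_ge0 ?(le_trans ler01 y1) //.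
    by rewrite -natrX ler_nat (leq_trans ss) // up_logP.
  apply: le_trans (lerD h1 h2) _.
  rewrite -{2}[w ^+ b]mul1r -mulrDl natr1 /v mulrA ler_wpM2r ?(ltW wb0) //.
  have be := bernoulli_exp b (ltW w1).
  have w1' : 0 < w - 1 by rewrite subr_gt0.
  have : b%:R <= (w - 1)^-1 * w ^+ b.
    rewrite mulrC ler_pdivlMr //; lra.
  have : 1 <= w ^+ b by rewrite exprn_ege1 // ltW.
  rewrite /c mulrDl -!natr1; lra.
(* Either [c * v] is within [eps * N], or [N < v / delta]; in the latter case
   [v ^ (kappa + 1) <= q * N ^ kappa] bounds [v] by the constant [q / delta ^ kappa]. *)
case: (lerP v (delta * N%:R)) => hv.
  apply: (@le_trans _ _ (eps * N%:R)).
    apply: (@le_trans _ _ (c * (delta * N%:R))); first by rewrite ler_pM2l.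
    by rewrite /delta mulrA [c * _]mulrC divfK // gt_eqF.
  by rewrite lerDl mulr_ge0 ?(ltW c0) // divr_ge0 ?(ltW q0) // exprn_ge0 // ltW.
apply: (@le_trans _ _ (c * (q%:R / delta ^+ kappa))); last first.
  by rewrite lerDr mulr_ge0 // ltW.
rewrite ler_pM2l // ler_pdivlMr ?exprn_gt0 //.
have vk0 : 0 < v ^+ kappa by rewrite exprn_gt0.
rewrite -(ler_pM2r vk0) (_ : _ * v ^+ kappa = v ^+ kappa.+1 * delta ^+ kappa); last first.
  by rewrite exprS; ring.
apply: (@le_trans _ _ (q%:R * N%:R ^+ kappa * delta ^+ kappa)).
  by rewrite ler_wpM2r // exprn_ge0 // ltW.
rewrite -mulrA -exprMn ler_wpM2l ?(ltW q0) // lerXn2r ?nnegrE ?(ltW v0) //.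
  by rewrite mulr_ge0 // ltW.
by rewrite mulrC ltW.
Qed.

Lemma real_root_exists (x : R) a : 1 < x -> (0 < a)%N -> exists2 w : R, 1 < w & w ^+ a = x.
Proof.
move=> x1 a0; have x0 : 0 < x by apply: lt_trans x1.
exists (expR (ln x / a%:R)).
  by rewrite expR_gt1 divr_gt0 ?ln_gt0 // ltr0n.
by rewrite -expRM_natr divfK ?pnatr_eq0 -?lt0n // lnK // posrE.
Qed.

Lemma prod_chsum_bound k kappa : exists K rho : R, [/\ 0 <= K, 0 < rho < 1 &
  forall N d Y m (n : 'I_k -> nat), (0 < N)%N -> d \is monic -> dirichlet d Y ->
    Y != principal_char C d -> m != 0 -> (deg m <= N ^ kappa)%N ->
    (\sum_i n i <= N)%N ->
    \prod_i cabs (chsum (n i) (restr m Y))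
      <= K * rho ^+ N * q%:R ^+ N * (q%:R ^+ deg d) ^+ k].
Proof.
have q1 := card_field_gt1 F; have q0 : (0 : R) < q%:R by rewrite ltr0n ltnW.
have [|//|w w1 wq] := @real_root_exists q%:R (2 * kappa.+1) _ _; first by rewrite ltr1n.
have w0 : 0 < w by lra.
have y1 : 1 <= q%:R / w.
  by rewrite ler_pdivlMr // mul1r -wq -[X in X <= _]expr1 ler_weXn2l ?ltW.
have y0 : 0 < q%:R / w by rewrite divr_gt0.
(* The sieve costs exp([eps * N]) for each of the [k] factors, in total [w ^ (N * k / (k + 1))],
   less than the gain [w ^ N]; hence [rho < 1]. *)
pose eps := ln w / k.+1%:R.
have lw : 0 < ln w by rewrite ln_gt0.
have eps0 : 0 < eps by rewrite divr_gt0.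
have [K K0 HK] := rankin w1 wq eps0.
exists (expR (K *+ k)), (expR (eps *+ k) / w); split; first exact: expR_ge0.
  rewrite divr_gt0 ?expR_gt0 //= ltr_pdivrMr // mul1r -[X in _ < X]lnK ?posrE //.
  rewrite ltr_expR /eps -mulr_natr mulrAC ltr_pdivrMr ?ltr0n //.
  by rewrite ltr_pM2l // ltr_nat.
move=> N d Y m n N0 dm Yd nY m0 mN nN.
have [s [us ss Hs Hn]] := sieve_bound dm Yd nY m0 y1.
have P1 : \prod_(p <- s) (1 + (q%:R / w) ^- deg p) <= expR (eps * N%:R + K).
  apply: (@le_trans _ _ (\prod_(p <- s) expR ((q%:R / w) ^- deg p))).
    apply: ler_prod => p _; rewrite expR_ge1Dx andbT addr_ge0 // invr_ge0 exprn_ge0 //.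
    exact: ltW.
  rewrite -expR_sum ler_expR; apply: HK => //.
  exact: leq_trans ss mN.
apply: (@le_trans _ _ (\prod_(i < k) (q%:R ^+ deg d * (q%:R / w) ^+ n i * expR (eps * N%:R + K)))).
  apply: ler_prod => i _; rewrite cabs_ge0 /=; apply: le_trans (Hn _) _.
  by rewrite ler_wpM2l // mulr_ge0 // exprn_ge0 // ltW.
rewrite big_split /= big_split /= !prodr_const card_ord.
have -> : \prod_(i < k) (q%:R / w) ^+ n i = (q%:R / w) ^+ (\sum_i n i).
  by rewrite -(big_morph _ (exprD _) (expr0 _)).
apply: (@le_trans _ _ ((q%:R ^+ deg d) ^+ k * (q%:R / w) ^+ N * expR (eps * N%:R + K) ^+ k)).
  rewrite ler_wpM2r ?exprn_ge0 ?expR_ge0 // ler_wpM2l ?exprn_ge0 ?(ltW q0) //.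
  exact: ler_weXn2l.
have -> : expR (eps * N%:R + K) ^+ k = expR (eps *+ k) ^+ N * expR (K *+ k).
  rewrite -!expRM_natr -expRD; congr expR.
  by rewrite -(mulr_natr eps k) -(mulr_natr K k); ring.
rewrite le_eqVlt; apply/orP; left; apply/eqP; rewrite !expr_div_n.
by field; rewrite expf_neq0 // gt_eqF.
Qed.

End Rankin.

(** * Growth condition and Siegel-Walfisz bound *)

Section SiegelWalfisz.
Variables (F : finFieldType) (R : realType).
Local Notation C := R[i].
Local Notation q := (#|F|).
Implicit Types (d e f g h l m r p : {poly F}) (n a b k : nat) (X Y : {poly F} -> C).
Local Notation polys := (polys F).
Local Notation mpolys := (mpolys F).

Lemma growth_tau k : growth_condition (fun f : {poly F} => (tau k f)%:R : C).
Proof.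
(* [k.+1] instead of [k], since the exponent has to be positive even for [k = 0]. *)
exists k.+1%:R; first by rewrite ltr0n.
exists 1 => f fm; rewrite mul1r cabs_nat powR_mulrn // -natrX ler_nat.
apply: leq_trans (tau_le_dv k fm) _; apply: leq_trans (leq_expl k (dv_le_tau2 fm)) _.
apply: leq_pexp2l => //; apply: leq_trans (dv_le_tau2 fm).
by rewrite dv_gt0 // monic_neq0.
Qed.

Lemma monic_genE m : m \is monic -> monic_gen m = m.
Proof. by move=> mm; rewrite /monic_gen (monicP mm) invr1 scale1r. Qed.

Lemma extend_dirichlet d (chi : {poly %/ monic_gen d} -> C) :
  d \is monic -> (1 < size d)%N -> is_character chi -> dirichlet d (extend chi).
Proof.
move=> dm sd [chi1 chiM]; have e := monic_genE dm.
have em : monic_gen d \is monic by rewrite e.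
have es : (1 < size (monic_gen d))%N by rewrite e.
have unitE f : (in_qpoly (monic_gen d) f \is a GRing.unit) = coprimep f d.
  by rewrite in_qpoly_unit // e.
split; rewrite /extend.
- by rewrite coprime1p in_qpoly1.
- move=> f g; rewrite coprimepMl; case: (boolP (coprimep f d)) => fd; last by rewrite mul0r.
  case: (boolP (coprimep g d)) => gd; last by rewrite mulr0.
  by rewrite /= in_qpolyM chiM ?unitE.
- move=> f; rewrite coprimep_modl.
  by rewrite -[in X in f %% X]e in_qpoly_modp.
by move=> f /negPf ->.
Qed.

Lemma restr1 r d Y : dirichlet d Y -> restr r Y 1 = 1.
Proof. by case=> Y1 _ _ _; rewrite /restr coprime1p. Qed.

Lemma restrM r d Y : dirichlet d Y -> {morph restr r Y : f g / f * g}.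
Proof.
case=> _ YM _ _ f g; rewrite /restr coprimepMl.
by case: coprimep; case: coprimep; rewrite ?mulr0 ?mul0r //= YM.
Qed.

Lemma pow_deg_le N a (D : R) : (0 < N)%N -> 0 <= D -> a%:R <= D * logq F (N%:R : R) ->
  (q%:R : R) ^+ a <= N%:R `^ D.
Proof.
move=> N0 D0 aD; have q1 := card_field_gt1 F.
have q0 : (0 : R) < q%:R by rewrite ltr0n ltnW.
have lq : 0 < ln (q%:R : R) by rewrite ln_gt0 // ltr1n.
rewrite -powR_mulrn ?(ltW q0) //; apply: (@le_trans _ _ (q%:R `^ (D * logq F N%:R))).
  by rewrite ler_powR // ler1n ltnW.
have N0' : (0 : R) < N%:R by rewrite ltr0n.
by rewrite /powR (gt_eqF q0) (gt_eqF N0') /logq mulrA divfK // gt_eqF.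
Qed.

Lemma nat_bound (D : R) : exists a : nat, D <= a%:R.
Proof.
case: (lerP 0 D) => D0; first by exists (Num.bound D); rewrite ltW // archi_boundP.
by exists 0%N; rewrite ltW.
Qed.

Lemma siegel_walfisz_tau k : siegel_walfisz (fun f : {poly F} => (tau k f)%:R : C).
Proof.
exists 1 => // D D1 kappa.
have [K1 [rho [K10 rho01 HK]]] := prod_chsum_bound F R k kappa.
have [a Da] := nat_bound D.
(* [3 * a] for the required power of N, [a * k] for the [k]-th power of [q ^ deg d], [k] for the
   number of degree tuples. *)
have [K2 K20 HK2] := poly_decay (3 * a + a * k + k) rho01.
exists (K1 * K2) => N N0 m chi d sm mN chiP nprin [[dm sd ddm [chi' chi'P chiE]] _] degd.
have D0 : 0 <= D by rewrite (le_trans ler01).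
have Yd := extend_dirichlet dm sd chi'P; set Y := extend chi' in Yd.
have m0 : m != 0 by rewrite -size_poly_gt0 (ltn_trans _ sm).
have XE : extend chi = restr m Y.
  apply: funext => f; rewrite /restr; case: ifPn => [/chiE //|fm].
  by rewrite /extend (negPf fm).
have nY : Y != principal_char C d.
  apply/eqP => e; apply: nprin => f fm; rewrite chiE // -/Y e.
  by rewrite /principal_char /restr (coprimep_dvdl ddm fm).
have qd : (q%:R : R) ^+ deg d <= N.+1%:R ^+ a.
  exact: le_trans (pow_deg_le N0 D0 degd) (powR_natS N0 Da).
have q0 : (0 : R) < q%:R by rewrite ltr0n ltnW // card_field_gt1.
have /andP [rho0 _] := rho01.
rewrite XE (sum_monic_of_deg N (fun f => (tau k f)%:R * restr m Y f)).
rewrite sum_tau ?(restr1 _ Yd) //; last exact: restrM Yd.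
apply: le_trans (cabs_sum _ _ _) _.
apply: (@le_trans _ _ (\sum_(n : {ffun 'I_k -> 'I_N.+1})
   (K1 * rho ^+ N * q%:R ^+ N * (N.+1%:R ^+ a) ^+ k))).
  rewrite big_mkcond; apply: ler_sum => n _.
  case: eqP => [nN|_].
    rewrite cabs_prod; apply: le_trans (HK N d Y m (fun i => n i) N0 dm Yd nY m0 mN _) _.
      by rewrite nN.
    rewrite ler_wpM2l ?mulr_ge0 ?exprn_ge0 ?(ltW rho0) ?(ltW q0) //.
    by rewrite lerXn2r ?nnegrE ?exprn_ge0 // ltW.
  by rewrite !mulr_ge0 ?exprn_ge0 ?(ltW rho0) ?(ltW q0).
rewrite sumr_const card_ffun !card_ord -[X in X <= _]mulr_natr natrX mulrA ler_pdivlMr; last first.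
  by rewrite powR_gt0 // ltr0n.
apply: (@le_trans _ _ (K1 * rho ^+ N * q%:R ^+ N * (N.+1%:R ^+ a) ^+ k * N.+1%:R ^+ k * N.+1%:R ^+ (3 * a))).
  rewrite ler_wpM2l ?mulr_ge0 ?exprn_ge0 ?(ltW rho0) ?(ltW q0) //.
  by apply: powR_natS => //; rewrite natrM ler_pM2l.
rewrite (_ : _ * _ = K1 * q%:R ^+ N * (N.+1%:R ^+ (3 * a + a * k + k) * rho ^+ N)); last first.
  by rewrite !exprD !exprM; ring.
rewrite -[X in _ <= X]mulrA [K2 * _]mulrC [X in _ <= X]mulrA.
by rewrite ler_wpM2l // mulr_ge0 // exprn_ge0 // ltW.
Qed.

End SiegelWalfisz.

(** * Bombieri-Vinogradov equidistribution *)

(** Lagrange's identity: the weighted double sum of the squares of [x i * y j - x j * y i] is twice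
    the difference of the two sides. *)
Lemma cauchy_schwarz_seq (R : realFieldType) (I : Type) (s : seq I) (w x y : I -> R) :
  (forall i, 0 <= w i) ->
  (\sum_(i <- s) w i * (x i * y i)) ^+ 2
    <= (\sum_(i <- s) w i * x i ^+ 2) * (\sum_(i <- s) w i * y i ^+ 2).
Proof.
move=> w0; set A := \sum_(i <- s) w i * x i ^+ 2; set B := \sum_(i <- s) w i * y i ^+ 2.
set S := \sum_(i <- s) _.
have : 0 <= \sum_(i <- s) \sum_(j <- s) w i * w j * (x i * y j - x j * y i) ^+ 2.
  by apply: sumr_ge0 => i _; apply: sumr_ge0 => j _; apply: mulr_ge0; [exact: mulr_ge0 | exact: sqr_ge0].
have -> : \sum_(i <- s) \sum_(j <- s) w i * w j * (x i * y j - x j * y i) ^+ 2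
   = A * B + B * A - 2 * S ^+ 2.
  have dd (f g : I -> R) : (\sum_(i <- s) f i) * (\sum_(j <- s) g j)
      = \sum_(i <- s) \sum_(j <- s) f i * g j.
    by rewrite mulr_suml; apply: eq_bigr => i _; rewrite mulr_sumr.
  rewrite expr2 /A /B /S !dd mulr_sumr -big_split -sumrB /=; apply: eq_bigr => i _.
  by rewrite mulr_sumr -big_split -sumrB /=; apply: eq_bigr => j _; ring.
by lra.
Qed.

Lemma ler_sum_inj (R : numDomainType) (I J : eqType) (s : seq I) (t : seq J)
    (phi : I -> J) (H : J -> R) : uniq s -> uniq t -> {in s &, injective phi} ->
  {in s, forall x, phi x \in t} -> (forall y, 0 <= H y) ->
  \sum_(x <- s) H (phi x) <= \sum_(y <- t) H y.
Proof.
move=> us ut inj sub H0; rewrite -(big_map phi predT H).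
rewrite [X in _ <= X](bigID (fun y => y \in map phi s)) /= -[X in X <= _]addr0; apply: lerD; last first.
  exact: sumr_ge0.
rewrite -[X in _ <= X]big_filter le_eqVlt; apply/orP; left; apply/eqP/perm_big.
apply: uniq_perm; rewrite ?map_inj_in_uniq ?filter_uniq //.
move=> y; rewrite mem_filter andb_idr // => /mapP [x xs ->]; exact: sub.
Qed.

Section LargeConductors.
Variables (F : finFieldType) (R : realType).
Local Notation C := R[i].
Local Notation q := (#|F|).
Implicit Types (d e f g h l m r p : {poly F}) (n a b k : nat) (X Y : {poly F} -> C).
Local Notation polys := (polys F).
Local Notation mpolys := (mpolys F).

Lemma large_sieve_real j n (c : {poly F} -> C) :
  \sum_(d <- mpolys j) (size (units d))%:R^-1 *
     \sum_(Y <- prim_chars C d) cabs (\sum_(f <- mpolys n) c f * Y f) ^+ 2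
  <= (q ^ (maxn n.+1 (2 * j) - j))%:R * \sum_(f <- mpolys n) cabs (c f) ^+ 2.
Proof.
have := large_sieve j n c; rewrite -lecR; congr (_ <= _).
  rewrite rmorph_sum; apply: eq_bigr => d _; rewrite rmorphM fmorphV rmorph_nat rmorph_sum.
  by congr (_ * _); apply: eq_bigr => Y _; rewrite rmorphXn.
rewrite rmorphM rmorph_nat rmorph_sum; congr (_ * _).
by apply: eq_bigr => Y _; rewrite rmorphXn.
Qed.

(** The large sieve average over conductors [d] of degree [a]; [r] stands for the cofactor [m / d]
    of a modulus, held fixed while [d] varies. *)
Definition conductor_sum k (n : 'I_k -> nat) a r : R :=
  \sum_(d <- mpolys a) (size (units d))%:R^-1 *
    \sum_(Y <- prim_chars C d) \prod_i cabs (chsum (n i) (restr r Y)).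

(** Coprimality to [r] is moved from the characters into the coefficients, whose mean square is a
    moment of the divisor function. *)
Lemma large_sieve_divisor_bounded a n k N r (b : {poly F} -> nat) :
  (forall f, f \is monic -> b f <= dv f ^ k)%N -> (n <= N)%N ->
  \sum_(d <- mpolys a) (size (units d))%:R^-1 *
     \sum_(Y <- prim_chars C d)
        cabs (\sum_(f <- mpolys n) (b f)%:R * restr r Y f) ^+ 2
  <= (q ^ (maxn n.+1 (2 * a) - a + n) * N.+1 ^ (2 ^ (2 * k)).-1)%:R :> R.
Proof.
move=> bd nN; pose c f : C := if coprimep f r then (b f)%:R else 0.
apply: (@le_trans _ _ ((q ^ (maxn n.+1 (2 * a) - a))%:R * \sum_(f <- mpolys n) cabs (c f) ^+ 2)).
  apply: le_trans (large_sieve_real a n c); apply: ler_sum => d _.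
  rewrite ler_wpM2l ?invr_ge0 //; apply: ler_sum => Y _.
  rewrite le_eqVlt; apply/orP; left; apply/eqP; congr (cabs _ ^+ _).
  by apply: eq_bigr => f _; rewrite /c /restr; case: coprimep; rewrite ?mulr0 ?mul0r.
rewrite expnD -mulnA natrM ler_wpM2l //.
apply: (@le_trans _ _ (\sum_(f <- mpolys n) dv f ^ (2 * k))%:R).
  rewrite natr_sum !big_seq; apply: ler_sum => f /mpolysP [fm _].
  rewrite /c; case: ifP => _; last by rewrite cabs0 expr0n.
  by rewrite cabs_nat -natrX ler_nat mulnC expnM leq_expl // bd.
rewrite ler_nat (leq_trans (sum_dv_exp F n (2 * k))) // leq_mul2l leq_expl ?orbT //.
Qed.

Lemma large_conductor k a r N (n : 'I_k -> nat) (i0 : 'I_k) nI nJ :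
  (\sum_i n i <= N)%N -> nI = n i0 -> nJ = (\sum_(i < k | i != i0) n i)%N ->
  conductor_sum n a r ^+ 2 <=
   (q ^ (maxn nI.+1 (2 * a) - a + nI + (maxn nJ.+1 (2 * a) - a + nJ))
     * (N.+1 ^ (2 ^ (2 * k)).-1) ^ 2)%:R.
Proof.
move=> nN nIE nJE.
have nE : (\sum_i n i = nI + nJ)%N by rewrite (bigD1 i0) //= nIE nJE.
have nIN : (nI <= N)%N by rewrite (leq_trans _ nN) // nE leq_addr.
have nJN : (nJ <= N)%N by rewrite (leq_trans _ nN) // nE leq_addl.
pose s := [seq n i | i <- enum 'I_k & i != i0].
have [b [bd bE]] := prod_chsum F s.
have ss : (size s <= k)%N by rewrite size_map (leq_trans (size_subseq (filter_subseq _ _))) // size_enum_ord.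
have sJ : sumn s = nJ by rewrite sumnE big_map big_filter big_enum_cond nJE.
have bd' f : f \is monic -> (b f <= dv f ^ k)%N.
  move=> fm; apply: leq_trans (bd f fm) _; apply: leq_pexp2l => //.
  by rewrite dv_gt0 // monic_neq0.
pose r2 := [seq (d, Y) | d <- mpolys a, Y <- prim_chars C d].
pose w (i : {poly F} * ({poly F} -> C)) : R := (size (units i.1))%:R^-1.
pose x (i : {poly F} * ({poly F} -> C)) := cabs (chsum nI (restr r i.2)).
pose y (i : {poly F} * ({poly F} -> C)) := cabs (\sum_(f <- mpolys nJ) (b f)%:R * restr r i.2 f).
have uE : conductor_sum n a r = \sum_(i <- r2) w i * (x i * y i).
  rewrite big_allpairs_dep /conductor_sum /=; apply: eq_big_seq => d /mpolysP [dm _].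
  rewrite mulr_sumr; apply: eq_big_seq => Y /(mem_prim_chars _ dm) [Yd _].
  rewrite /w /x /y /= (bigD1 i0) //= nIE; congr (_ * (_ * _)).
  rewrite -sJ -(bE _ (restr r Y)); last 2 first.
  - exact: restr1 Yd.
  - exact: restrM Yd.
  by rewrite cabs_prod big_map big_filter big_enum_cond.
rewrite uE; apply: le_trans (cauchy_schwarz_seq _ _ _ _) _; first by move=> i; rewrite invr_ge0.
rewrite expnD -mulnn mulnACA natrM.
have pairE (z : {poly F} * ({poly F} -> C) -> R) : \sum_(i <- r2) w i * z i ^+ 2
    = \sum_(d <- mpolys a) (size (units d))%:R^-1 * \sum_(Y <- prim_chars C d) z (d, Y) ^+ 2.
  by rewrite big_allpairs_dep /=; apply: eq_bigr => d _; rewrite mulr_sumr.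
apply: ler_pM.
- by apply: sumr_ge0 => i _; rewrite mulr_ge0 ?invr_ge0 // sqr_ge0.
- by apply: sumr_ge0 => i _; rewrite mulr_ge0 ?invr_ge0 // sqr_ge0.
(* The split-off factor is the case of coefficients 1, which are divisor-bounded as well. *)
- rewrite pairE; apply: le_trans (large_sieve_divisor_bounded a r (b := fun=> 1%N) _ nIN); last first.
    by move=> f fm; rewrite expn_gt0 dv_gt0 // monic_neq0.
  apply: ler_sum => d _; rewrite ler_wpM2l ?invr_ge0 //; apply: ler_sum => Y _.
  rewrite /x /chsum /= le_eqVlt; apply/orP; left; apply/eqP; congr (cabs _ ^+ _).
  by apply: eq_bigr => f _; rewrite mul1r.
- by rewrite pairE; apply: large_sieve_divisor_bounded.
Qed.

End LargeConductors.

(** [e] is the exponent of [q] for the square of the conductor sum, to be compared with [2 * N].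
    Both degrees below [2 * a] give the first alternative, neither below it the second. In the mixed
    cases the longer one is either [nI], at most N / 2, or [nJ], at most [k / (k + 1)] times N
    because [nI] is the largest. *)
Lemma sieve_exponent_cases k a N Q nI nJ : (nI + nJ <= N)%N -> (nI + nJ <= k * nI)%N ->
  (nI <= Q)%N -> (2 * Q <= N)%N -> (a <= Q)%N ->
  let e := (maxn nI.+1 (2 * a) - a + nI + (maxn nJ.+1 (2 * a) - a + nJ))%N in
  [\/ (e <= 2 * Q + N)%N, (e + 2 * a <= 2 * N + 2)%N
    | (2 * k.+1 * e + N <= 2 * k.+1 * (2 * N + 1))%N].
Proof.
move=> hN hk hQ hQN haQ e.
have [h1|h1] := leqP nI.+1 (2 * a); have [h2|h2] := leqP nJ.+1 (2 * a).
- constructor 1; rewrite /e; lia.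
- constructor 3; have -> : e = (nJ.+1 + (nI + nJ))%N by rewrite /e; lia.
  have : (k.+1 * nJ <= k * N)%N by nia.
  nia.
- constructor 3; have -> : e = (nI.+1 + (nI + nJ))%N by rewrite /e; lia.
  have : (2 * (nI.+1 + (nI + nJ)) <= 3 * N + 2)%N by lia.
  nia.
- constructor 2; rewrite /e; lia.
Qed.

Section Assembly.
Variables (F : finFieldType) (R : realType).
Local Notation C := R[i].
Local Notation q := (#|F|).
Implicit Types (d e f g h l m r p : {poly F}) (n a b k : nat) (X Y : {poly F} -> C).
Local Notation polys := (polys F).
Local Notation mpolys := (mpolys F).

Lemma conductor_sum_ge0 k (n : 'I_k -> nat) a r : 0 <= conductor_sum R n a r.
Proof.
apply: sumr_ge0 => d _; rewrite mulr_ge0 ?invr_ge0 //; apply: sumr_ge0 => Y _.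
by apply: prodr_ge0 => i _; apply: cabs_ge0.
Qed.

(** There are at most [size (units d)] primitive characters modulo [d], which cancels the weight,
    and [q ^ a] moduli. *)
Lemma conductor_sum_le k (n : 'I_k -> nat) a r (z : R) : 0 <= z ->
  (forall d Y, d \in mpolys a -> primitive_char d Y ->
     \prod_i cabs (chsum (n i) (restr r Y)) <= z) ->
  conductor_sum R n a r <= q%:R ^+ a * z.
Proof.
move=> z0 Hz; apply: (@le_trans _ _ (\sum_(d <- mpolys a) z)); last first.
  by rewrite sum_const_seq size_mpolys -natrX mulr_natl.
rewrite /conductor_sum !big_seq; apply: ler_sum => d da; have [dm _] := mpolysP _ _ da.
have u0 : (0 : R) < (size (units d))%:R by rewrite ltr0n units_gt0.
rewrite ler_pdivrMl //; apply: (@le_trans _ _ (\sum_(Y <- prim_chars C d) z)).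
  rewrite !big_seq; apply: ler_sum => Y /(mem_prim_chars _ dm); exact: Hz.
rewrite sum_const_seq -[X in X <= _]mulr_natl ler_wpM2r // ler_nat -(size_chars C dm).
by rewrite size_filter count_size.
Qed.

Lemma natS_exp_le N a : (0 < N)%N -> (N.+1 ^ a <= 2 ^ a * N ^ a)%N.
Proof. by move=> N0; rewrite -expnMn leq_expl //; lia. Qed.

Lemma argmax_sum k (n : 'I_k.+1 -> nat) : exists i0, (\sum_i n i <= k.+1 * n i0)%N.
Proof.
case: (@arg_maxnP _ ord0 predT n) => // i0 _ hi; exists i0.
apply: (@leq_trans (\sum_(i < k.+1) n i0)%N).
  by apply: leq_sum => i _; apply: hi.
by rewrite sum_nat_const card_ord.
Qed.

Lemma large_conductor_bound k E : exists D (K : R), [/\ (E <= D)%N, 0 <= K &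
  forall N Q a r (n : 'I_k.+1 -> nat), (0 < N)%N -> (2 * Q <= N)%N ->
    (q ^ (2 * Q) * N ^ (2 * D) <= q ^ N)%N ->
    (\sum_i n i <= N)%N -> (forall i, n i <= Q)%N -> (a <= Q)%N ->
    (N.+1 ^ D <= q ^ a)%N ->
    conductor_sum R n a r * N.+1%:R ^+ E <= K * q%:R ^+ N].
Proof.
have q1 := card_field_gt1 F; have q0 : (0 : R) < q%:R by rewrite ltr0n ltnW.
(* [E0] is the power of [N.+1] lost to the divisor moments, [E] the power to be gained. *)
pose E0 := (2 ^ (2 * k.+1)).-1; pose D := (E0 + E)%N.
have [|//|w w1 wq] := @real_root_exists R q%:R (2 * k.+2) _ _; first by rewrite ltr1n.
have w0 : 0 < w by apply: lt_trans w1.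
have [|K2 K20 HK2] := @poly_decay R w^-1 (2 * D).
  by rewrite invr_gt0 w0 invf_lt1.
(* Beyond the 1, one term for each alternative of [sieve_exponent_cases]: the savings are
   [N ^ (2 * D)] from the level, [q ^ (2 * a)] from the conductor, and [w ^ N], respectively. *)
pose K : R := 1 + (2 ^ (2 * D))%:R + q%:R ^+ 2 + K2 * q%:R.
have K1 : 1 <= K.
  rewrite /K -!addrA lerDl !addr_ge0 ?exprn_ge0 ?(ltW q0) //.
  by rewrite mulr_ge0 // ltW.
exists D, K; split; [exact: leq_addl | exact: le_trans ler01 K1 |].
move=> N Q a r n N0 QN Qq nN nQ aQ Da.
have [i0 hi0] := argmax_sum n.
pose nJ := (\sum_(i < k.+1 | i != i0) n i)%N.
have nE : (\sum_i n i = n i0 + nJ)%N by rewrite (bigD1 i0).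
have := @large_conductor F R k.+1 a r N n i0 (n i0) nJ nN erefl erefl.
set e := (_ + _ + (_ + _))%N => U2.
rewrite nE in nN hi0.
have ec := sieve_exponent_cases nN hi0 (nQ i0) QN aQ; rewrite /= -/e in ec.
have qe : (q ^ e)%:R * N.+1%:R ^+ (2 * D) <= K * (q%:R ^+ N) ^+ 2 :> R.
  have s1 x : 0 <= x -> x <= K -> x * (q%:R ^+ N) ^+ 2 <= K * (q%:R ^+ N) ^+ 2 :> R.
    by move=> _ xK; rewrite ler_wpM2r // sqr_ge0.
  have p1 : (0 : R) <= (2 ^ (2 * D))%:R by [].
  have p2 : 0 <= q%:R ^+ 2 :> R by rewrite sqr_ge0.
  have p3 : 0 <= K2 * q%:R by rewrite mulr_ge0 // ltW.
  case: ec => h.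
  - apply: le_trans (s1 _ p1 _); last by rewrite /K; lra.
    rewrite -!natrX -!natrM ler_nat -expnM mulnC.
    apply: (leq_trans (leq_mul (natS_exp_le (2 * D) N0) (leq_pexp2l (ltnW q1) h))).
    rewrite -mulnA leq_mul2l; apply/orP; right.
    rewrite expnD mulnA [(N ^ _ * _)%N]mulnC (leq_trans (leq_mul Qq (leqnn _))) //.
    by rewrite -expnD muln2 addnn.
  - apply: le_trans (s1 _ p2 _); last by rewrite /K; lra.
    rewrite -!natrX -!natrM ler_nat -expnM -expnD.
    apply: (@leq_trans (q ^ e * q ^ (2 * a))%N).
      by rewrite leq_mul2l mulnC expnM [(2 * a)%N]mulnC expnM leq_expl ?orbT.
    by rewrite -expnD leq_pexp2l ?(ltnW q1) // addnC mulnC addnC; lia.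
  - apply: le_trans (s1 _ p3 _); last by rewrite /K; lra.
    have hK := HK2 N; rewrite exprVn in hK.
    have wN0 : 0 < w ^+ N by rewrite exprn_gt0.
    rewrite ler_pdivrMr // in hK.
    apply: (@le_trans _ _ ((q ^ e)%:R * (K2 * w ^+ N))); first by rewrite ler_wpM2l.
    have : (q ^ e)%:R * w ^+ N <= q%:R * (q%:R ^+ N) ^+ 2.
      rewrite natrX -wq -!exprM -!exprD ler_weXn2l ?(ltW w1) //.
      by rewrite (leq_trans h) //; lia.
    move=> hw; rewrite mulrCA -mulrA.
    by rewrite ler_pM2l.
have U0 := conductor_sum_ge0 n a r.
rewrite -(@ler_pXn2r _ 2) ?nnegrE ?mulr_ge0 ?exprn_ge0 ?(le_trans ler01 K1) ?(ltW q0) //.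
rewrite exprMn [X in _ <= X]exprMn.
apply: (@le_trans _ _ ((q ^ e * (N.+1 ^ E0) ^ 2)%:R * (N.+1%:R ^+ E) ^+ 2)).
  by rewrite ler_wpM2r // sqr_ge0.
rewrite (_ : _ * _ = (q ^ e)%:R * N.+1%:R ^+ (2 * D)); last first.
  by rewrite natrM !natrX [(2 * D)%N]mulnC exprM /D exprD; ring.
apply: le_trans qe _; rewrite ler_wpM2r ?sqr_ge0 // expr2 ler_peMl //.
exact: le_trans ler01 K1.
Qed.

(** The threshold is [q ^ a] against [N.+1 ^ D]: above it the large sieve applies, below it the
    exponential saving for single characters outweighs any power of N. *)
Lemma conductor_bound k E : exists D (K : R), [/\ 0 <= K &
  forall N Q a r (n : 'I_k -> nat), (0 < N)%N -> (2 * Q <= N)%N ->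
    (q ^ (2 * Q) * N ^ (2 * D) <= q ^ N)%N ->
    (\sum_i n i <= N)%N -> (forall i, n i <= Q)%N -> (0 < a <= Q)%N ->
    r \is monic -> (deg r <= N)%N ->
    conductor_sum R n a r * N.+1%:R ^+ E <= K * q%:R ^+ N].
Proof.
have q1 := card_field_gt1 F; have q0 : (0 : R) < q%:R by rewrite ltr0n ltnW.
case: k => [|k].
  (* For [k = 0] there is no degree to split off; the product is empty and the bound [q ^ a], with
     [a <= Q], suffices by the choice of level. *)
  exists E, (2 ^ E)%:R; split=> // N Q a r n N0 QN Qq _ _ /andP [a0 aQ] _ _.
  apply: (@le_trans _ _ (q%:R ^+ a * 1 * N.+1%:R ^+ E)).
    rewrite ler_wpM2r ?exprn_ge0 //; apply: conductor_sum_le => // d Y _ _.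
    by rewrite big_ord0.
  rewrite mulr1 -!natrX -!natrM ler_nat mulnC.
  apply: leq_trans (leq_mul (natS_exp_le E N0) (leq_pexp2l (ltnW q1) aQ)) _.
  rewrite -mulnA leq_mul2l; apply/orP; right.
  rewrite -(@leq_exp2r _ _ 2) // expnMn -!expnM mulnC [(Q * 2)%N]mulnC [(E * 2)%N]mulnC.
  by rewrite (leq_trans Qq) // leq_pexp2l ?(ltnW q1) // muln2 -addnn leq_addr.
have [D [K1 [ED K10 H1]]] := large_conductor_bound k E.
have [K2 [rho [K20 rho01 H2]]] := prod_chsum_bound F R k.+1 1.
(* [k.+2] powers of [q ^ a]: [k.+1] from the factors and one from the number of conductors, each at
   most [N.+1 ^ D]. *)
have [K3 K30 H3] := poly_decay (D * k.+2 + E) rho01.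
have /andP [rho0 _] := rho01.
have K4 : 0 <= K2 * q%:R ^+ k.+2 * K3.
  by apply: mulr_ge0; [apply: mulr_ge0 => //; apply: exprn_ge0; apply: ltW | apply: ltW].
exists D, (K1 + K2 * q%:R ^+ k.+2 * K3); split; first exact: addr_ge0.
move=> N Q a r n N0 QN Qq nN nQ /andP [a0 aQ] rm rN.
have [big_a|small_a] := leqP (N.+1 ^ D) (q ^ a).
  apply: le_trans (H1 N Q a r n N0 QN Qq nN nQ aQ big_a) _.
  by rewrite ler_wpM2r ?exprn_ge0 ?lerDl // ltW.
have qa : q%:R ^+ a <= N.+1%:R ^+ D :> R by rewrite -!natrX ler_nat ltnW.
pose z := K2 * rho ^+ N * q%:R ^+ N * (q%:R ^+ a) ^+ k.+1.
have z0 : 0 <= z by rewrite /z !mulr_ge0 ?exprn_ge0 ?(ltW q0) ?(ltW rho0).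
apply: (@le_trans _ _ (q%:R ^+ a * z * N.+1%:R ^+ E)).
  rewrite ler_wpM2r ?exprn_ge0 //; apply: conductor_sum_le => // d Y.
  rewrite mem_mpolys_deg => /andP [dm /eqP da] Yp; have [Yd _] := Yp.
  have d0 : (0 < deg d)%N by rewrite da.
  have := H2 N d Y r n N0 dm Yd (primitive_nonprincipal dm d0 Yp) (monic_neq0 rm).
  by rewrite expn1 da; apply.
apply: (@le_trans _ _ (K2 * K3 * q%:R ^+ N)); last first.
  rewrite ler_wpM2r ?exprn_ge0 ?(ltW q0) // (@le_trans _ _ (K2 * q%:R ^+ k.+2 * K3)) ?lerDr //.
  rewrite ler_wpM2r ?(ltW K30) // ler_peMr // exprn_ege1 // ler1n ltnW //.
rewrite (_ : _ * _ = K2 * q%:R ^+ N * ((q%:R ^+ a) ^+ k.+2 * N.+1%:R ^+ E * rho ^+ N)); last first.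
  by rewrite /z [(q%:R ^+ a) ^+ k.+2]exprS; move: (_ ^+ k.+1) (_ ^+ E) (q%:R ^+ N) (rho ^+ N) => x1 x2 x3 x4; ring.
rewrite -[X in _ <= X]mulrA [K3 * _]mulrC [X in _ <= X]mulrA ler_wpM2l ?mulr_ge0 ?exprn_ge0 ?(ltW q0) //.
apply: le_trans (H3 N); rewrite exprD exprM ler_wpM2r ?exprn_ge0 ?(ltW rho0) //.
rewrite ler_wpM2r ?exprn_ge0 // lerXn2r ?nnegrE ?exprn_ge0 // ltW //.
Qed.

End Assembly.

(** * From discrepancies to averages over primitive characters *)

Section BombieriVinogradov.
Variables (F : finFieldType) (R : realType).
Local Notation C := R[i].
Local Notation q := (#|F|).
Implicit Types (d e f g h l m r p : {poly F}) (n a b k : nat) (X Y : {poly F} -> C).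
Local Notation polys := (polys F).
Local Notation mpolys := (mpolys F).

Definition char_prod k (n : 'I_k -> nat) X : R := \prod_i cabs (chsum (n i) X).

Lemma char_prod_ge0 k (n : 'I_k -> nat) X : 0 <= char_prod n X.
Proof. by apply: prodr_ge0 => i _; apply: cabs_ge0. Qed.

Lemma sum_tau_le k M m X : m \is monic -> dirichlet m X ->
  cabs (\sum_(f <- mpolys M) (tau k f)%:R * X f) <=
  \sum_(n : {ffun 'I_k -> 'I_M.+1} | (\sum_i n i == M)%N) char_prod (fun i => n i) X.
Proof.
move=> mm [X1 XM _ _]; rewrite sum_tau //; apply: le_trans (cabs_sum _ _ _) _.
by apply: ler_sum => n _; rewrite cabs_prod.
Qed.

Lemma discrepancy_le M m l (psi : {poly F} -> C) : m \is monic -> coprimep m l ->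
  cabs (discrepancy M m l psi) <= (size (units m))%:R^-1 *
   \sum_(X <- chars C m | X != principal_char C m) cabs (\sum_(f <- mpolys M) psi f * X f).
Proof.
move=> mm; rewrite coprimep_sym => lm; have [l' ll'] := inverse_modp lm.
have -> : discrepancy M m l psi =
   \sum_(f <- mpolys M | (m %| f - l)%R) psi f
    - (size (units m))%:R^-1 * \sum_(f <- mpolys M | coprimep f m) psi f.
  have sm (P : pred {poly F}) :
      \sum_(f : {poly_M.+1 F} | monic_of_deg f && P f) psi f = \sum_(f <- mpolys M | P f) psi f.
    by rewrite [RHS]big_mkcond -(sum_monic_of_deg M (fun f => if P f then psi f else 0)) big_mkcondr.
  by rewrite /discrepancy phi_units // (sm (fun f => m %| f - l)) (sm (fun f => coprimep f m)).
rewrite (discrepancy_chars M psi mm lm ll') cabsM cabs_natV ler_wpM2l ?invr_ge0 //.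
apply: le_trans (cabs_sum _ _ _) _.
rewrite big_seq_cond [X in _ <= X]big_seq_cond; apply: ler_sum => X /andP [/(mem_chars _ mm) Xm _].
rewrite cabsM ler_piMl ?cabs_ge0 // -cabs_le; exact: dirichlet_norm_le1 mm Xm.
Qed.

(** Sending a character to the primitive one inducing it is injective, and only the principal
    character has conductor 1. The restriction is to [m %/ d] because [Y] already vanishes off the
    units of [d]; this separates the cofactor from the conductor. *)
Lemma sum_chars_primitive m (G : ({poly F} -> C) -> R) : m \is monic -> (forall X, 0 <= G X) ->
  \sum_(X <- chars C m | X != principal_char C m) G X <=
  \sum_(d <- divs m) if (0 < deg d)%N then
     \sum_(Y <- prim_chars C d) G (restr (m %/ d) Y) else 0.
Proof.
move=> mm G0; have m0 := monic_neq0 mm.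
have ch X : exists p : {poly F} * ({poly F} -> C), dirichlet m X ->
    [/\ p.1 \is monic, p.1 %| m, primitive_char p.1 p.2 & X = restr m p.2].
  have [Xm|nX] := pselect (dirichlet m X); last by exists (0, X).
  by have [d [Y H]] := primitive_exists mm Xm; exists (d, Y).
have {ch} [w wP] := choice ch.
pose t := [seq (d, Y) | d <- [seq d <- divs m | (0 < deg d)%N], Y <- prim_chars C d].
rewrite -big_filter.
have restrE d Y : d \is monic -> d %| m -> dirichlet d Y -> restr (m %/ d) Y = restr m Y.
  move=> dm ddm [_ _ _ Y0]; apply: funext => f; rewrite /restr -{2}(divpK ddm) coprimepMr.
  by case: coprimep => //=; case: ifPn => // /Y0.
apply: (@le_trans _ _ (\sum_(z <- t) G (restr (m %/ z.1) z.2))); last first.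
  by rewrite big_allpairs_dep big_filter big_mkcond.
rewrite (eq_big_seq (fun X => G (restr (m %/ (w X).1) (w X).2))) => [|X]; last first.
  rewrite mem_filter => /andP [_ /(mem_chars _ mm) Xm]; have [dm ddm [Yd _] XE] := wP X Xm.
  by rewrite (restrE _ _ dm ddm Yd) -XE.
apply: (@ler_sum_inj _ _ _ _ t w (fun z => G (restr (m %/ z.1) z.2))) => //.
- by rewrite filter_uniq //; case: (charsP C mm).
- apply: allpairs_uniq_dep; first by rewrite filter_uniq ?divs_uniq.
    move=> d; rewrite mem_filter => /andP [_]; rewrite mem_divs // => /andP [dm _].
    exact: prim_chars_uniq.
  by move=> [d Y] [d' Y'] _ _ /= [-> ->].
- move=> X X'; rewrite !mem_filter => /andP [_ /(mem_chars _ mm) Xm] /andP [_ /(mem_chars _ mm) Xm'] e.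
  by have [_ _ _ ->] := wP X Xm; have [_ _ _ ->] := wP X' Xm'; rewrite e.
move=> X; rewrite mem_filter => /andP [nX /(mem_chars _ mm) Xm].
have [dm ddm Yp XE] := wP X Xm; apply/allpairsPdep; exists (w X).1, (w X).2.
split; last by rewrite -surjective_pairing.
  rewrite mem_filter mem_divs // dm ddm !andbT lt0n; apply/eqP => d0; case/negP: nX.
  have d1 : (w X).1 = 1.
    by have := monic_mpolys dm; rewrite d0 (perm_mem (mpolys0 F)) inE => /eqP.
  apply/eqP; rewrite XE; apply: funext => f; rewrite /principal_char /restr.
  case: Yp => [[Y1 YM per _] _]; case: ifP => // _.
  by rewrite -per d1 modp1 -Y1 -[RHS]per d1 modp1.
by apply/mem_prim_chars.
Qed.

(** Write [m = d * r] and bound the inverse totient of [m] by [dv r / q ^ deg r] times that of [d].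
    For fixed [r] the sum over [d] is a conductor sum. The three factors [Q.+1] come from the degree
    of [m], the degree of [d], and the average of [dv r]. *)
Lemma char_prod_sum_le k (n : 'I_k -> nat) Q (v : R) : 0 <= v ->
  ((forall i, n i <= Q)%N -> forall a r, (0 < a <= Q)%N -> r \is monic -> (deg r <= Q)%N ->
     conductor_sum R n a r <= v) ->
  \sum_(t < Q.+1) \sum_(m <- mpolys t) (size (units m))%:R^-1 *
     \sum_(X <- chars C m | X != principal_char C m) char_prod n X <= Q.+1%:R ^+ 3 * v.
Proof.
move=> v0 Hv; have q1 := card_field_gt1 F; have q0 : (0 : R) < q%:R by rewrite ltr0n ltnW.
(* If some degree exceeds [Q], it is at least [deg m] for all [m] considered, and every product
   vanishes. *)
have [nQ|/existsNP [i0 /negP]] := pselect (forall i, n i <= Q)%N; last first.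
  rewrite -ltnNge => Qn; rewrite big1 ?mulr_ge0 ?exprn_ge0 // => t _.
  rewrite big1_seq // => m /andP [_]; rewrite mem_mpolys_deg => /andP [mm /eqP mt].
  rewrite big1_seq ?mulr0 // => X /andP [nX /(mem_chars _ mm) Xm].
  rewrite /char_prod (bigD1 i0) //= (_ : chsum (n i0) X = 0) ?cabs0 ?mul0r //.
  have mn : (deg m <= n i0)%N by rewrite mt (leq_trans _ (ltnW Qn)) // -ltnS.
  rewrite /chsum -(subnK mn) (@sum_mpolys_periodic F C m) //; last by case: Xm.
  by rewrite (sum_nonprincipal mm Xm nX) mul0rn.
have {Hv} Hv := Hv nQ.
have -> : Q.+1%:R ^+ 3 * v = \sum_(t < Q.+1) Q.+1%:R ^+ 2 * v.
  by rewrite sumr_const card_ord -[RHS]mulr_natl exprS mulrA.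
apply: ler_sum => t _; have tQ : (t <= Q)%N by rewrite -ltnS.
pose H d r : R := if (0 < deg d)%N then (dv r)%:R / q%:R ^+ deg r *
   ((size (units d))%:R^-1 * \sum_(Y <- prim_chars C d) char_prod n (restr r Y)) else 0.
apply: (@le_trans _ _ (\sum_(m <- mpolys t) \sum_(d <- divs m) H d (m %/ d))).
  rewrite !big_seq; apply: ler_sum => m /mpolysP [mm _]; have m0 := monic_neq0 mm.
  have um : (0 : R) < (size (units m))%:R by rewrite ltr0n units_gt0.
  rewrite ler_pdivrMl //; apply: le_trans (sum_chars_primitive mm (char_prod_ge0 n)) _.
  rewrite mulr_sumr !big_seq; apply: ler_sum => d; rewrite mem_divs // => /andP [dm ddm].
  rewrite /H; case: ifP => _; last by rewrite mulr0.
  have rm : m %/ d \is monic by rewrite -(monicMr _ dm) divpK.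
  rewrite !mulrA ler_peMl //.
    by apply: sumr_ge0 => Y _; apply: char_prod_ge0.
  have ud : (0 : R) < (size (units d))%:R by rewrite ltr0n units_gt0.
  rewrite ler_pdivlMr // mul1r ler_pdivlMr ?exprn_gt0 // -natrX -!natrM ler_nat.
  have := units_mul_ge dm rm; rewrite [d * _]mulrC divpK // => le.
  by rewrite (leq_trans le) // mulnC.
rewrite sum_dirichlet_conv expr2 -mulrA.
apply: (@le_trans _ _ (\sum_(a < t.+1) Q.+1%:R * v)); last first.
  rewrite sumr_const card_ord -[X in X <= _]mulr_natl ler_wpM2r ?mulr_ge0 //.
  by rewrite ler_nat.
apply: ler_sum => a _; have at_ : (a <= t)%N by rewrite -ltnS.
case: (posnP a) => a0.
  rewrite big1_seq ?mulr_ge0 // => d /andP [_]; rewrite mem_mpolys_deg => /andP [_ /eqP da].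
  by rewrite big1 // => r _; rewrite /H da a0.
rewrite exchange_big /=.
apply: (@le_trans _ _ (\sum_(r <- mpolys (t - a)) (dv r)%:R / q%:R ^+ (t - a) * v)).
  rewrite !big_seq; apply: ler_sum => r; rewrite mem_mpolys_deg => /andP [rm /eqP rt].
  rewrite (eq_big_seq (fun d => (dv r)%:R / q%:R ^+ (t - a) *
     ((size (units d))%:R^-1 * \sum_(Y <- prim_chars C d) char_prod n (restr r Y)))) => [|d]; last first.
    by rewrite mem_mpolys_deg => /andP [_ /eqP da]; rewrite /H da a0 rt.
  rewrite -mulr_sumr ler_wpM2l ?divr_ge0 ?exprn_ge0 ?(ltW q0) //.
  apply: Hv => //; first by rewrite a0 (leq_trans at_).
  by rewrite rt (leq_trans (leq_subr _ _)).
rewrite -!mulr_suml ler_wpM2r // ler_pdivrMr ?exprn_gt0 // -natr_sum -natrX -natrM ler_nat.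
have := sum_dv_exp F (t - a) 1; rewrite expn1 mulnC.
under eq_bigr do rewrite expn1.
move=> le; apply: (leq_trans le); rewrite leq_mul2r expn1 ltnS.
by rewrite (leq_trans (leq_subr _ _)) ?orbT.
Qed.

Lemma sum_monic_le N Q (P : pred {poly F}) (H : {poly F} -> R) :
  (forall m, P m -> deg m <= Q)%N -> (forall m, 0 <= H m) ->
  \sum_(m : {poly_N F} | ((m : {poly F}) \is monic) && P m) H m <=
  \sum_(t < Q.+1) \sum_(m <- mpolys t) H m.
Proof.
move=> PQ H0.
have -> : \sum_(m : {poly_N F} | ((m : {poly F}) \is monic) && P m) H m
   = \sum_(m <- [seq m <- polys N | (m \is monic) && P m]) H m.
  by rewrite big_filter big_map big_enum_cond.
have -> : \sum_(t < Q.+1) \sum_(m <- mpolys t) H m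
   = \sum_(m <- [seq m | t <- iota 0 Q.+1, m <- mpolys t]) H m.
  by rewrite big_allpairs_dep -[iota _ _]/(index_iota 0 Q.+1) big_mkord.
apply: (@ler_sum_inj _ _ _ _ _ id H) => //.
- by rewrite filter_uniq ?polys_uniq.
- apply: allpairs_uniq_dep; [exact: iota_uniq | by move=> t _; apply: mpolys_uniq |].
  move=> u v /allpairsPdep [t [m [_ + ->]]] /allpairsPdep [t' [m' [_ + ->]]] /= e.
  by rewrite e !mem_mpolys_deg => /andP [_ /eqP ->] /andP [_ /eqP ->].
move=> m; rewrite mem_filter => /andP [/andP [mm Pm] _].
apply/allpairsPdep; exists (deg m), m; split=> //; last exact: monic_mpolys.
by rewrite mem_iota add0n ltnS PQ.
Qed.

(** Exponentiating the level condition: this is the only way in which the logarithmic gap below N /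
    2 enters the estimates. *)
Lemma level_bound N Q D (B : R) : (0 < N)%N -> D%:R <= B ->
  Q%:R <= N%:R / 2 - B * logq F (N%:R : R) ->
  (2 * Q <= N)%N /\ (q ^ (2 * Q) * N ^ (2 * D) <= q ^ N)%N.
Proof.
move=> N0 DB hQ; have q1 := card_field_gt1 F; have q0 : (0 : R) < q%:R by rewrite ltr0n ltnW.
have lq : 0 < ln (q%:R : R) by rewrite ln_gt0 // ltr1n.
have lN : 0 <= ln (N%:R : R) by rewrite ln_ge0 // ler1n.
have lg : 0 <= logq F (N%:R : R) by rewrite divr_ge0 // ltW.
have B0 : 0 <= B by apply: le_trans DB.
have DL : D%:R * logq F (N%:R : R) <= B * logq F N%:R by rewrite ler_wpM2r.
have BL : 0 <= B * logq F (N%:R : R) by rewrite mulr_ge0.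
split; first by rewrite -(ler_nat R) natrM; lra.
rewrite -(ler_nat R) natrM !natrX.
have N0' : (0 : R) < N%:R by rewrite ltr0n.
rewrite -ler_ln ?posrE ?mulr_gt0 ?exprn_gt0 // lnM ?posrE ?exprn_gt0 // !lnXn //.
have lE : logq F N%:R * ln (q%:R : R) = ln N%:R by rewrite /logq divfK // gt_eqF.
rewrite -(mulr_natr (ln q%:R) (2 * Q)) -(mulr_natr (ln N%:R) (2 * D)) -(mulr_natr (ln q%:R) N) -lE !natrM.
have -> : ln q%:R * (2 * Q%:R) + logq F N%:R * ln q%:R * (2 * D%:R)
   = ln q%:R * (2 * Q%:R + 2 * (D%:R * logq F (N%:R : R))) by ring.
by rewrite ler_pM2l //; lra.
Qed.

Lemma bombieri_vinogradov_tau k : bombieri_vinogradov (fun f : {poly F} => (tau k f)%:R : C).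
Proof.
move=> A A0; have [a0 Aa] := nat_bound A.
(* [a0] for the required saving, [k] for the degree tuples, 1 for the values of [M], and 3 from
   [char_prod_sum_le]. The constant [B] is then [D.+1], positive also for [D = 0]. *)
have [D [K [K0 HK]]] := conductor_bound F R k (a0 + k + 4).
exists D.+1%:R; first by rewrite ltr0n.
have q1 := card_field_gt1 F; have q0 : (0 : R) < q%:R by rewrite ltr0n ltnW.
exists K => N N0; set x := N%:R / 2 - _.
have NA : (0 : R) < N%:R `^ A by rewrite powR_gt0 // ltr0n.
(* For [x < 0] there are no moduli, and [Num.truncn x] would not be a lower bound for [x]. *)
case: (ltP x 0) => x0.
  rewrite big_pred0 => [|m]; first by rewrite mulr_ge0 // divr_ge0 ?exprn_ge0 ?(ltW q0) ?(ltW NA).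
  by apply/negP => /andP [_ /le_lt_trans /(_ x0)]; rewrite ltrn0.
pose Q := Num.truncn x.
have Qx : Q%:R <= x by rewrite truncn_le.
have PQ m : (deg m)%:R <= x -> (deg m <= Q)%N by rewrite -truncn_ge_nat.
have [|QN Qq] := @level_bound N Q D D.+1%:R N0 _ Qx; first by rewrite ler_nat.
pose V : R := K * q%:R ^+ N / N.+1%:R ^+ (a0 + k + 4).
have V0 : 0 <= V by rewrite divr_ge0 ?mulr_ge0 ?exprn_ge0 ?(ltW q0).
have V3 : 0 <= N.+1%:R ^+ 3 * V by apply: mulr_ge0 => //; apply: exprn_ge0.
(* A bound for the discrepancy free of [l]; the maximum over [M] is then replaced by the sum. *)
pose T (m : {poly F}) (M : nat) : R := (size (units m))%:R^-1 *
  \sum_(X <- chars C m | X != principal_char C m)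
  \sum_(n : {ffun 'I_k -> 'I_M.+1} | (\sum_i n i == M)%N) char_prod (fun i => n i) X.
have T0 m M : 0 <= T m M.
  rewrite mulr_ge0 ?invr_ge0 //; apply: sumr_ge0 => X _; apply: sumr_ge0 => n _.
  exact: char_prod_ge0.
apply: (@le_trans _ _ (\sum_(m : {poly_N.+1 F} | ((m : {poly F}) \is monic) && ((deg m)%:R <= x))
    \sum_(M < N.+1) T m M)).
  apply: ler_sum => m /andP [mm _]; apply: bigmax_le; first by apply: sumr_ge0.
  move=> M _; apply: (@le_trans _ _ (T m M)); last first.
    by rewrite (bigD1 M) //= lerDl sumr_ge0.
  apply: bigmax_le => // l ml; apply: le_trans (discrepancy_le M _ mm ml) _.
  rewrite ler_wpM2l ?invr_ge0 // big_seq_cond [X in _ <= X]big_seq_cond.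
  by apply: ler_sum => X /andP [/(mem_chars _ mm) Xm _]; apply: sum_tau_le mm Xm.
apply: le_trans (sum_monic_le (Q := Q) (P := fun m => (deg m)%:R <= x) (H := fun m => \sum_(M < N.+1) T m M) _ _ _) _.
- exact: PQ.
- by move=> m; apply: sumr_ge0.
(* The degree tuple moves outside the moduli, since the large sieve estimate is for one tuple and
   all conductors at once. *)
have -> : \sum_(t < Q.+1) \sum_(m <- mpolys t) \sum_(M < N.+1) T m M =
   \sum_(M < N.+1) \sum_(n : {ffun 'I_k -> 'I_M.+1} | (\sum_i n i == M)%N)
    \sum_(t < Q.+1) \sum_(m <- mpolys t) (size (units m))%:R^-1 *
     \sum_(X <- chars C m | X != principal_char C m) char_prod (fun i => n i) X.
  under eq_bigr do rewrite exchange_big /=.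
  rewrite exchange_big /=; apply: eq_bigr => M _.
  rewrite [RHS]exchange_big /=; apply: eq_bigr => t _.
  rewrite [RHS]exchange_big /=; apply: eq_bigr => m _.
  by rewrite /T -mulr_sumr exchange_big.
apply: (@le_trans _ _ (\sum_(M < N.+1) N.+1%:R ^+ k * (N.+1%:R ^+ 3 * V))).
  apply: ler_sum => M _; have MN : (M <= N)%N by rewrite -ltnS.
  apply: (@le_trans _ _ (\sum_(n : {ffun 'I_k -> 'I_M.+1}) N.+1%:R ^+ 3 * V)).
    rewrite [X in X <= _]big_mkcond; apply: ler_sum => n _; case: eqP => [nM|_]; last first.
      by rewrite mulr_ge0 ?exprn_ge0.
    apply: le_trans (char_prod_sum_le (v := V) V0 _) _.
      move=> nQ a r aQ rm rQ; rewrite /V ler_pdivlMr ?exprn_gt0 ?ltr0n //.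
      apply: (HK N Q a r (fun i => n i) N0 QN Qq _ nQ aQ rm).
        by rewrite nM.
      by rewrite (leq_trans rQ) //; lia.
    by rewrite ler_wpM2r // lerXn2r ?nnegrE // ler_nat ltnS; lia.
  rewrite sumr_const card_ffun !card_ord -[X in X <= _]mulr_natl ler_wpM2r //.
  by rewrite natrX lerXn2r ?nnegrE // ler_nat ltnS.
rewrite sumr_const card_ord -[X in X <= _]mulr_natl.
have N1 : (0 : R) < N.+1%:R by rewrite ltr0n.
have -> : N.+1%:R * (N.+1%:R ^+ k * (N.+1%:R ^+ 3 * V)) = K * (q%:R ^+ N / N.+1%:R ^+ a0).
  rewrite /V !exprD; field.
  by rewrite nat1r !expf_neq0 ?(gt_eqF N1).
rewrite ler_wpM2l // ler_wpM2l ?exprn_ge0 ?(ltW q0) // lef_pV2 ?posrE ?exprn_gt0 //.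
exact: powR_natS.
Qed.

End BombieriVinogradov.

Theorem corollary1p4 (R : realType) (F : finFieldType) (k : nat) :
  let psi : {poly F} -> R[i] := fun f => (tau k f)%:R in
  [/\ growth_condition psi, siegel_walfisz psi & bombieri_vinogradov psi].
Proof.
move=> psi; split; first exact: growth_tau.
  exact: siegel_walfisz_tau.
exact: bombieri_vinogradov_tau.
Qed.
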